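(* Let $(M^m,g)$ be a Riemannian spin manifold of dimension $m$ which carries a nontrivial parallel spinor. Then for any Riemannian manifold $(N^{m+1},h)$ of dimension $m+1$ and any harmonic map $f\colon M^m\to N^{m+1}$, there exists a non-identically-vanishing $\Phi\in C^\infty(M,\Sigma M\otimes f^*TN)$ such that $(f,\Phi)$ is a Dirac-harmonic map.
   Context: $M$ carries a fixed spin structure with (complex) spinor bundle $\Sigma M$, its Levi-Civita connection $\nabla^{\Sigma M}$ and natural Hermitian inner product $\langle\cdot,\cdot\rangle$; Clifford multiplication ''$\cdot$'' satisfies $X\cdot Y\cdot+Y\cdot X\cdot=-2g(X,Y)$ and is skew-Hermitian for each tangent vector. $M$ and $N$ are not assumed complete. A parallel spinor is a section $\psi$ of $\Sigma M$ with $\nabla^{\Sigma M}\psi=0$. The map $f$ is harmonic if $\mathrm{tr}_g(\nabla df)=0$. For a smooth map $f\colon M\to N$, $\Sigma M\otimes f^*TN$ denotes the real tensor product, with the natural Hermitian inner product induced by that of $\Sigma M$ and by $h$, and the tensor product connection; Clifford multiplication acts on the first factor. The twisted Dirac operator is $D^f:=\sum_{j=1}^m e_j\cdot\nabla_{e_j}^{\Sigma M\otimes f^*TN}$, where $(e_j)$ is a local orthonormal frame on $M$. A pair $(f,\Phi)$ with $\Phi\in C^\infty(M,\Sigma M\otimes f^*TN)$ is a Dirac-harmonic map if $D^f\Phi=0$ and $\mathrm{tr}_g(\nabla df)=\frac12V_\Phi$, where $V_\Phi\in C^\infty(M,f^*TN)$ is defined by $h(V_\Phi,Y)=\sum_{j=1}^m\langle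 e_j\cdot R^N_{Y,f_*e_j}\Phi,\Phi\rangle$ for all $Y\in f^*TN$. Here $e_j\cdot R^N_{Y,f_*e_j}\Phi$ means $(e_j\cdot\otimes R^N_{Y,f_*e_j})\Phi$, and $R^N_{X,Y}=[\nabla^N_X,\nabla^N_Y]-\nabla^N_{[X,Y]}$. *)

(* Defs.v *)
From HB Require Import structures.
From mathcomp Require Import all_boot all_order all_algebra.
From mathcomp Require Import complex.
From mathcomp Require Import all_classical all_reals all_analysis.

Set Implicit Arguments.
Unset Strict Implicit.
Unset Printing Implicit Defensive.

Import Order.TTheory GRing.Theory Num.Theory.
Import numFieldNormedType.Exports.

Local Open Scope classical_set_scope.
Local Open Scope ring_scope.

(* Conventions.  A geometric object on a manifold is the family of its local
   representatives, one for each chart (or local orthonormal frame), subject to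
   the transition law.  A representative is a total function of the point of
   the manifold, and only its values over the domain of its chart (or frame)
   are meaningful: every condition below is guarded accordingly. *)

Definition evec (R : realType) (n : nat) (k : 'I_n) : 'cV[R]_n :=
  delta_mx k ord0.

(* [Ck k A u], for A open in R^n: u is of class C^k on A. *)
Fixpoint Ck (R : realType) (n k : nat) (A : set 'cV[R]_n) (u : 'cV[R]_n -> R)
    : Prop :=
  (forall x, A x -> {for x, continuous u}) /\
  match k with
  | 0 => True
  | k'.+1 => forall i : 'I_n,
      (forall x, A x -> derivable u x (evec R i)) /\ Ck k' A ('D_(evec R i) u)
  end.

(* Smooth n-manifolds, given by an atlas; they need not be connected. *)
Record manifold (R : realType) (n : nat) := Manifold {
  mpt :> topologicalType;
  mpt_hausdorff : hausdorff_space mpt;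
  mpt_second_countable : @second_countable mpt;
  cidx : Type;
  dom : cidx -> set mpt;
  chart : cidx -> mpt -> 'cV[R]_n;
  chart_inv : cidx -> 'cV[R]_n -> mpt;
  dom_open : forall i, open (dom i);
  dom_cover : forall p, exists i, dom i p;
  chart_open : forall i, open (chart i @` dom i);
  chartK : forall i p, dom i p -> chart_inv i (chart i p) = p;
  chart_continuous : forall i p, dom i p -> {for p, continuous (chart i)};
  chart_inv_continuous : forall i x, (chart i @` dom i) x ->
    {for x, continuous (chart_inv i)};
  chart_smooth : forall i j (a : 'I_n) k,
    Ck k (chart i @` (dom i `&` dom j))
         (fun x => chart j (chart_inv i x) a ord0)
}.

Section Calculus.
Context {R : realType} {n : nat} (M : manifold R n).

Definition smooth_on (A : set M) (u : M -> R) : Prop :=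
  forall (i : cidx M) (k : nat),
    Ck k (chart i @` (A `&` dom i)) (u \o chart_inv i).

Definition csmooth_on (A : set M) (u : M -> complex R) : Prop :=
  smooth_on A (fun p => complex.Re (u p)) /\
  smooth_on A (fun p => complex.Im (u p)).

(* partial derivative at p with respect to the k-th coordinate of chart i *)
Definition pd (i : cidx M) (k : 'I_n) (u : M -> R) (p : M) : R :=
  'D_(evec R k) (u \o chart_inv i) (chart i p).

(* derivative along the tangent vector with components v in chart i *)
Definition dird (i : cidx M) (v : 'cV[R]_n) (u : M -> R) (p : M) : R :=
  \sum_k v k ord0 * pd i k u p.

Definition dird_cV (N : nat) (i : cidx M) (v : 'cV[R]_n) (Y : M -> 'cV[R]_N)
    (p : M) : 'cV[R]_N :=
  \col_k dird i v (fun q => Y q k ord0) p.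

Definition dird_mxC (d N : nat) (i : cidx M) (v : 'cV[R]_n)
    (A : M -> 'M[complex R]_(d, N)) (p : M) : 'M[complex R]_(d, N) :=
  \matrix_(r, s) Complex (dird i v (fun q => complex.Re (A q r s)) p)
                         (dird i v (fun q => complex.Im (A q r s)) p).

(* Jacobian at p of the change of coordinates from chart i to chart j *)
Definition jac (i j : cidx M) (p : M) : 'M[R]_n :=
  \matrix_(a, b) pd i b (fun q => chart j q a ord0) p.

End Calculus.

(* [gmet i p] is the Gram matrix of the coordinate basis of chart i at p. *)
Record riemannian (R : realType) (n : nat) := Riemannian {
  rman :> manifold R n;
  gmet : cidx rman -> rman -> 'M[R]_n;
  gmet_sym : forall i p, dom i p -> (gmet i p)^T = gmet i p;
  gmet_pos : forall i p (v : 'cV[R]_n), dom i p -> v != 0 ->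
    0 < (v^T *m gmet i p *m v) ord0 ord0;
  gmet_smooth : forall i (a b : 'I_n),
    smooth_on (dom i) (fun p => gmet i p a b);
  gmet_change : forall i j p, dom i p -> dom j p ->
    gmet i p = (jac i j p)^T *m gmet j p *m jac i j p
}.

Section LeviCivita.
Context {R : realType} {n : nat} (M : riemannian R n).
Implicit Types (i : cidx M) (p : M) (X Y : M -> 'cV[R]_n).

Definition rdot i p (x y : 'cV[R]_n) : R := (x^T *m gmet i p *m y) ord0 ord0.

(* Christoffel symbol Gamma^c_{ab} of the Levi-Civita connection in chart i *)
Definition christoffel i (c a b : 'I_n) p : R :=
  2^-1 * \sum_l invmx (gmet i p) c l *
    (pd i a (fun q => gmet i q b l) p + pd i b (fun q => gmet i q a l) p
     - pd i l (fun q => gmet i q a b) p).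

(* Levi-Civita derivative of Y along X; both fields are given by their
   components in chart i. *)
Definition cov i X Y p : 'cV[R]_n :=
  dird_cV i (X p) Y p +
  \col_c \sum_a \sum_b christoffel i c a b p * X p a ord0 * Y p b ord0.

Definition lie_bracket i X Y p : 'cV[R]_n :=
  dird_cV i (X p) Y p - dird_cV i (Y p) X p.

(* R_{x,y} z = ([nabla_X, nabla_Y] - nabla_[X,Y]) Z, extending the vectors
   x, y, z to fields X, Y, Z with constant components in chart i. *)
Definition curvature i p (x y z : 'cV[R]_n) : 'cV[R]_n :=
  let X := fun _ : M => x in
  let Y := fun _ : M => y in
  let Z := fun _ : M => z in
  cov i X (cov i Y Z) p - cov i Y (cov i X Z) p
  - cov i (lie_bracket i X Y) Z p.

Definition curvature_mx i p (x y : 'cV[R]_n) : 'M[R]_n :=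
  \matrix_(a, b) curvature i p x y (evec R b) a ord0.

End LeviCivita.

(* A complex Clifford module with X Y + Y X = -2 <X, Y> for R^m, of dimension
   2^(m/2) (hence irreducible), in which vectors are skew-Hermitian. *)
Record clifford_module (R : realType) (m : nat) := CliffordModule {
  gam : 'I_m -> 'M[complex R]_(2 ^ m./2);
  gam_anticomm : forall k l,
    gam k *m gam l + gam l *m gam k = (- 2 * (k == l)%:R)%:M;
  gam_skew : forall k, map_mx Num.conj (gam k)^T = - gam k
}.

Section SpinGroup.
Context {R : realType} {m : nat} (G : clifford_module R m).

Definition clif (v : 'cV[R]_m) : 'M[complex R]_(2 ^ m./2) :=
  \sum_k real_complex R (v k ord0) *: gam G k.

(* The group Spin(m), whose elements are the products of evenly many unit
   vectors, acts faithfully on the module and is identified with its image. *)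
Definition in_spin (s : 'M[complex R]_(2 ^ m./2)) : Prop :=
  exists vs : seq 'cV[R]_m,
    [/\ ~~ odd (size vs),
        forall v, v \in vs -> \sum_k v k ord0 ^+ 2 = 1 &
        s = \big[mulmx/1%:M]_(v <- vs) clif v].

(* s is mapped to T by Spin(m) -> SO(m), that is s v s^-1 = T v for v in R^m;
   for s in Spin(m) this forces T to be orthogonal of determinant 1. *)
Definition spin_over (s : 'M[complex R]_(2 ^ m./2)) (T : 'M[R]_m) : Prop :=
  in_spin s /\ forall v : 'cV[R]_m, s *m clif v = clif (T *m v) *m s.

End SpinGroup.

(* A spin structure (and the orientation underlying it): an open cover by
   domains of smooth orthonormal frames, and a lift to Spin(m) of the cocycle
   of transition matrices of these frames.  [frame a i p] has as columns the
   components in chart i of the vectors of the frame a at p. *)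
Record spin_structure (R : realType) (m : nat) (M : riemannian R m)
    (G : clifford_module R m) := SpinStructure {
  sidx : Type;
  sdom : sidx -> set M;
  sdom_open : forall a, open (sdom a);
  sdom_cover : forall p, exists a, sdom a p;
  frame : sidx -> cidx M -> M -> 'M[R]_m;
  frame_smooth : forall a i (k l : 'I_m),
    smooth_on (sdom a `&` dom i) (fun p => frame a i p k l);
  frame_change : forall a i j p, sdom a p -> dom i p -> dom j p ->
    frame a j p = jac i j p *m frame a i p;
  frame_orthonormal : forall a i p, sdom a p -> dom i p ->
    (frame a i p)^T *m gmet i p *m frame a i p = 1%:M;
  lift : sidx -> sidx -> M -> 'M[complex R]_(2 ^ m./2);
  lift_smooth : forall a b k l,
    csmooth_on (sdom a `&` sdom b) (fun p => lift a b p k l);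
  lift_cocycle : forall a b c p, sdom a p -> sdom b p -> sdom c p ->
    lift a b p *m lift b c p = lift a c p;
  lift_over : forall a b i p (T : 'M[R]_m),
    sdom a p -> sdom b p -> dom i p ->
    frame b i p = frame a i p *m T -> spin_over G (lift a b p) T
}.

Section Spinors.
Context {R : realType} {m : nat} {M : riemannian R m}
  {G : clifford_module R m} (S : spin_structure M G).
Notation C := (complex R).
Notation d := (2 ^ m./2)%N.

(* Spinor fields: sections of the bundle associated with the spin structure *)
Definition spinor_field (psi : sidx S -> M -> 'cV[C]_d) : Prop :=
  (forall a r, csmooth_on (sdom a) (fun p => psi a p r ord0)) /\
  (forall a b p, sdom a p -> sdom b p -> psi a p = lift a b p *m psi b p).

(* 1/4 sum_{k,l} g(nabla_v e_k, e_l) e_k . e_l . , the local form in the frame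
   a of the connection induced on spinors by the Levi-Civita connection; v is
   given by its components in chart i. *)
Definition spin_connection (a : sidx S) (i : cidx M) (v : 'cV[R]_m) (p : M)
    : 'M[C]_d :=
  4^-1 *: \sum_k \sum_l
    real_complex R
      (rdot i p (cov i (fun _ => v) (fun q => col k (frame a i q)) p)
                (col l (frame a i p)))
    *: (gam G k *m gam G l).

Definition parallel_spinor (psi : sidx S -> M -> 'cV[C]_d) : Prop :=
  spinor_field psi /\
  forall a i p (v : 'cV[R]_m), sdom a p -> dom i p ->
    dird_mxC i v (psi a) p + spin_connection a i v p *m psi a p = 0.

Definition nontrivial_spinor (psi : sidx S -> M -> 'cV[C]_d) : Prop :=
  exists a p, sdom a p /\ psi a p <> 0.

End Spinors.

Section Maps.
Context {R : realType} {m n : nat} {M : riemannian R m} {N : riemannian R n}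
  (f : M -> N).
Implicit Types (i : cidx M) (j : cidx N) (p : M).

Definition smooth_map : Prop :=
  continuous f /\
  forall j (a : 'I_n),
    smooth_on (f @^-1` dom j) (fun p => chart j (f p) a ord0).

(* matrix of f_* at p in chart i of M and chart j of N *)
Definition dmap i j p : 'M[R]_(n, m) :=
  \matrix_(a, b) pd i b (fun q => chart j (f q) a ord0) p.

(* Sections of f^*TN, given by their components in the charts of N *)
Definition field_along (W : cidx N -> M -> 'cV[R]_n) : Prop :=
  (forall j a, smooth_on (f @^-1` dom j) (fun p => W j p a ord0)) /\
  (forall j j' p, dom j (f p) -> dom j' (f p) ->
     W j' p = jac j j' (f p) *m W j p).

(* connection matrix, along v, of the pullback to f^*TN of the Levi-Civita
   connection of N, in the coordinate basis of chart j *)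
Definition pullback_connection i j (v : 'cV[R]_m) p : 'M[R]_n :=
  \matrix_(c, b) \sum_a christoffel j c a b (f p) * (dmap i j p *m v) a ord0.

Definition cov_along i j (v : 'cV[R]_m) (W : M -> 'cV[R]_n) p : 'cV[R]_n :=
  dird_cV i v W p + pullback_connection i j v p *m W p.

(* (nabla df)(x, y) = nabla_x (df Y) - df (nabla_x Y), extending y to a field Y
   with constant components in chart i *)
Definition second_fundamental_form i j p (x y : 'cV[R]_m) : 'cV[R]_n :=
  cov_along i j x (fun q => dmap i j q *m y) p
  - dmap i j p *m cov i (fun _ => x) (fun _ => y) p.

(* tr_g (nabla df) *)
Definition tension i j p : 'cV[R]_n :=
  \sum_a \sum_b invmx (gmet i p) a b *:
    second_fundamental_form i j p (evec R a) (evec R b).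

Definition harmonic_map : Prop :=
  smooth_map /\
  forall i j p, dom i p -> dom j (f p) -> tension i j p = 0.

End Maps.

Section DiracHarmonic.
Context {R : realType} {m n : nat} {M : riemannian R m} {N : riemannian R n}
  {G : clifford_module R m} (S : spin_structure M G) (f : M -> N).
Notation C := (complex R).
Notation d := (2 ^ m./2)%N.
Implicit Types (a : sidx S) (i : cidx M) (j : cidx N) (p : M).

(* The fibre of Sigma M (x)_R f^*TN is C^d (x)_R R^n = M_{d,n}(C): the entry
   (r, c) is the coefficient of sigma_r (x) d/dy^c.  An endomorphism A (x) B is
   then P |-> A P B^T. *)
Definition tensor_act (A : 'M[C]_d) (B : 'M[R]_n) (P : 'M[C]_(d, n))
    : 'M[C]_(d, n) :=
  A *m P *m (map_mx (real_complex R) B)^T.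

Definition twisted_section (Phi : sidx S -> cidx N -> M -> 'M[C]_(d, n))
    : Prop :=
  [/\ forall a j r c,
        csmooth_on (sdom a `&` f @^-1` dom j) (fun p => Phi a j p r c),
      forall a b j p, sdom a p -> sdom b p -> dom j (f p) ->
        Phi a j p = tensor_act (lift a b p) 1%:M (Phi b j p) &
      forall a j j' p, sdom a p -> dom j (f p) -> dom j' (f p) ->
        Phi a j' p = tensor_act 1%:M (jac j j' (f p)) (Phi a j p)].

Definition nontrivial_twisted (Phi : sidx S -> cidx N -> M -> 'M[C]_(d, n))
    : Prop :=
  exists a j p, [/\ sdom a p, dom j (f p) & Phi a j p <> 0].

(* Hermitian product induced on the fibre over p by that of spinors and by h *)
Definition twisted_herm j p (P Q : 'M[C]_(d, n)) : C :=
  \sum_b \sum_c real_complex R (gmet j (f p) b c) *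
    \sum_r P r b * Num.conj (Q r c).

Definition twisted_cov a i j (v : 'cV[R]_m) (P : M -> 'M[C]_(d, n)) p
    : 'M[C]_(d, n) :=
  dird_mxC i v P p
  + tensor_act (spin_connection a i v p) 1%:M (P p)
  + tensor_act 1%:M (pullback_connection f i j v p) (P p).

Definition twisted_dirac a i j (P : M -> 'M[C]_(d, n)) p : 'M[C]_(d, n) :=
  \sum_k tensor_act (gam G k) 1%:M
    (twisted_cov a i j (col k (frame a i p)) P p).

(* V is the field V_Phi:
   h(V, Y) = sum_k < e_k . R^N_{Y, f_* e_k} Phi, Phi > for all Y. *)
Definition is_V (Phi : sidx S -> cidx N -> M -> 'M[C]_(d, n))
    (V : cidx N -> M -> 'cV[R]_n) : Prop :=
  field_along f V /\
  forall a i j p (y : 'cV[R]_n), sdom a p -> dom i p -> dom j (f p) ->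
    real_complex R (rdot j (f p) (V j p) y) =
    \sum_k twisted_herm j p
      (tensor_act (gam G k)
         (curvature_mx j (f p) y (dmap f i j p *m col k (frame a i p)))
         (Phi a j p))
      (Phi a j p).

Definition dirac_harmonic (Phi : sidx S -> cidx N -> M -> 'M[C]_(d, n))
    : Prop :=
  [/\ smooth_map f, twisted_section Phi,
      forall a i j p, sdom a p -> dom i p -> dom j (f p) ->
        twisted_dirac a i j (Phi a j) p = 0 &
      exists2 V, is_V Phi V &
        forall i j p, dom i p -> dom j (f p) ->
          tension f i j p = 2^-1 *: V j p].

End DiracHarmonic.

(* Main.v *)
(* Let psi be a nontrivial parallel spinor, and consider
   Phi = sum_k e_k . psi (x) df(e_k).  Since psi is parallel,
   nabla_v Phi = sum_k e_k . psi (x) (nabla df)(v, e_k), and by symmetry of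
   nabla df the Clifford relations turn D^f Phi into - psi (x) tr(nabla df),
   which vanishes as f is harmonic.  Moreover V_Phi = 0: in
   sum <e_k e_l psi, e_q psi> h(R(Y, f_* e_k) f_* e_l, f_* e_q) the
   antisymmetry of the curvature in (l, q) makes only the totally
   antisymmetric part of the coefficient count, and that part is killed by the
   Bianchi identity.  So Phi solves the problem unless it vanishes identically.

   In that case df = 0 wherever psi <> 0.  As |psi| is locally constant, the
   set where psi <> 0 and f takes a given value y0 is open and closed; on it
   take Phi = psi (x) v for a fixed v in T_{y0} N, and 0 elsewhere.

   Both cases need elementary calculus for C^k functions given by their
   partial derivatives: the mean value theorem along coordinate segments yields
   the chain rule, the symmetry of second derivatives, and the local constancy
   of functions with vanishing partial derivatives. *)

Require Import Defs.
From mathcomp Require Import all_boot all_order all_algebra.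
From mathcomp Require Import complex ring lra.
From mathcomp Require Import all_classical all_reals all_analysis.

Set Implicit Arguments.
Unset Strict Implicit.
Unset Printing Implicit Defensive.

Import Order.TTheory GRing.Theory Num.Theory.
Import numFieldNormedType.Exports.

Local Open Scope classical_set_scope.
Local Open Scope ring_scope.

(** * Partial derivatives in R^n *)

Section CalculusRn.
Context {R : realType}.

(** An orthonormal frame is not parallel, and the formula for nabla_v Phi rests on a cancellation.
    Let w be the antisymmetric matrix of entries g(nabla_v e_k, e_l). The spin connection is 1/4 sum
    w_kl e_k e_l, whose commutator with e_j is sum_l w_jl e_l; summed over the frame, these
    commutators cancel the terms df(nabla_v e_k). The same matrix explains why |psi| is locally
    constant: the adjoint of e_k e_l is e_l e_k, so the spin connection is skew-Hermitian. That Phi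
    = 0 forces df = 0 where psi <> 0 is seen one component of the target at a time: component c of
    Phi is the Clifford product of the real vector u = (df^c(e_k))_k with psi, and u . u . psi = -
    |u|^2 psi. As M need not be connected, psi may vanish on some components of M while f varies
    there. The second section therefore has to be cut off to a union of components, and its
    definition branches on membership in that set. *)

Lemma is_derive_line (V W : normedModType R) (w : V -> W) (y v : V) (s : R) :
  derivable w (y + s *: v) v ->
  is_derive s (1 : R) (fun t : R => w (y + t *: v)) ('D_v w (y + s *: v)).
Proof.
move=> dw.
have E : (fun h : R => h^-1 *: (w (y + (h *: (1 : R) + s) *: v) - w (y + s *: v)))
       = (fun h : R => h^-1 *: (w (h *: v + (y + s *: v)) - w (y + s *: v))).
  apply/funext => h; congr (_ *: (w _ - _)).
  by rewrite [h *: 1]mulr1 scalerDl addrCA addrA [h *: v + _]addrC.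
split; first by rewrite /derivable /= E; exact: dw.
by rewrite /derive /= E.
Qed.

(** The increment [t] may have either sign, so the mean value theorem is applied on [[0, t]] or on
    [[t, 0]]; the bound on [|s|] covers both. *)
Lemma MVT_line (V : normedModType R) (w : V -> R) (y v : V) (t : R) :
  (forall s : R, `|s| <= `|t| -> derivable w (y + s *: v) v) ->
  exists2 s : R, `|s| <= `|t| & w (y + t *: v) - w y = t * 'D_v w (y + s *: v).
Proof.
move=> dw; pose phi (s : R) := w (y + s *: v).
have dphi (s : R) : `|s| <= `|t| -> is_derive s (1 : R) phi ('D_v w (y + s *: v)).
  by move=> st; apply: is_derive_line; exact: dw.
have cphi (a b : R) : (forall s : R, s \in `[a, b] -> `|s| <= `|t|) ->
    {within `[a, b], continuous phi}.
  move=> ab; apply: derivable_within_continuous => s /ab /dphi.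
  by case.
have phi0 : phi 0 = w y by rewrite /phi scale0r addr0.
have [t0|t0] := leP 0 t.
- have le (s : R) : s \in `[0, t] -> `|s| <= `|t|.
    by rewrite in_itv/= => /andP[s0 st]; rewrite !ger0_norm.
  have [||c /le ct] := @MVT_segment _ phi (fun s => 'D_v w (y + s *: v)) 0 t t0.
  + by move=> s /subset_itv_oo_cc /le; exact: dphi.
  + exact: cphi.
  + by rewrite phi0 subr0 mulrC => E; exists c.
- have le (s : R) : s \in `[t, 0] -> `|s| <= `|t|.
    by rewrite in_itv/= => /andP[s0 st]; rewrite !ler0_norm ?lerN2// ltW.
  have [||c /le ct] :=
      @MVT_segment _ phi (fun s => 'D_v w (y + s *: v)) t 0 (ltW t0).
  + by move=> s /subset_itv_oo_cc /le; exact: dphi.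
  + exact: cphi.
  + rewrite phi0 sub0r mulrN => /eqP; rewrite -eqr_oppLR opprB mulrC => /eqP E.
    by exists c.
Qed.

(** The path from [x] to [y] changes one coordinate at a time. Balls are those of the sup norm, so
    every edge of the path stays inside, and the mean value theorem bounds the increment along
    it. *)
Lemma partials_lipschitz n (w : 'cV[R]_n -> R) (x : 'cV[R]_n) (r e : R) :
  (forall y, ball x r y -> forall k, derivable w y (evec R k) /\
     `|'D_(evec R k) w y| <= e) ->
  forall y, ball x r y ->
  `|w y - w x| <= e * \sum_k `|y k ord0 - x k ord0|.
Proof.
move=> dw y [r0 xy].
(* The corners of the path: [z j] has the first [j] coordinates of [y] and the others of [x]. *)
pose z j : 'cV[R]_n := \col_k (if (k < j)%N then y k ord0 else x k ord0).
have z0 : z 0 = x by apply/colP => k; rewrite mxE ltn0.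
have zn : z n = y by apply/colP => k; rewrite mxE ltn_ord.
have -> : w y - w x = \sum_(k < n) (w (z k.+1) - w (z k)).
  by rewrite -(big_mkord xpredT (fun k => w (z k.+1) - w (z k))) telescope_sumr// z0 zn.
rewrite mulr_sumr.
apply: (le_trans (ler_norm_sum _ _ _)); apply: ler_sum => k _.
have zS : z k.+1 = z k + (y k ord0 - x k ord0) *: evec R k.
  apply/colP => l; rewrite !mxE eqxx andbT ltnS leq_eqVlt.
  have [->|lk] := eqVneq l k.
    by rewrite eqxx /= ltnn mulr1 addrC subrK.
  by rewrite val_eqE (negbTE lk)/= mulr0 addr0.
have zb (s : R) : `|s| <= `|y k ord0 - x k ord0| -> ball x r (z k + s *: evec R k).
  move=> sk; split=> // a b; rewrite !mxE !ord1 eqxx andbT.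
  have [->|ak] := eqVneq a k.
    rewrite ltnn mulr1 /ball /= opprD addrA subrr sub0r normrN.
    by apply: le_lt_trans sk _; have := xy k ord0; rewrite /ball /= distrC.
  rewrite mulr0 addr0; case: ifP => _; last exact: ballxx.
  exact: xy.
rewrite zS.
have [|s sk ->] := @MVT_line _ w (z k) (evec R k) (y k ord0 - x k ord0).
  by move=> s /zb /dw /(_ k) [].
rewrite normrM mulrC ler_wpM2r//.
by have [] := dw _ (zb _ sk) k.
Qed.

Lemma zero_partials_cst n (w : 'cV[R]_n -> R) (x : 'cV[R]_n) (r : R) :
  (forall y, ball x r y -> forall k, derivable w y (evec R k) /\
     'D_(evec R k) w y = 0) ->
  forall y, ball x r y -> w y = w x.
Proof.
move=> dw y xy; apply/eqP; rewrite -subr_eq0 -normr_le0.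
apply: le_trans (partials_lipschitz (e := 0) _ xy) _; last by rewrite mul0r.
by move=> z /dw dz k; have [? ->] := dz k; rewrite normr0.
Qed.

Lemma near_forall (T : topologicalType) (I : finType) (x : T) (P : I -> T -> Prop) :
  (forall i, \forall y \near x, P i y) -> \forall y \near x, forall i, P i y.
Proof. by move=> H; apply: filter_forall. Qed.

Definition C1_at n (u : 'cV[R]_n -> R) (b : 'cV[R]_n) : Prop :=
  forall k, (\forall y \near b, derivable u y (evec R k)) /\
            {for b, continuous ('D_(evec R k) u)}.

(** Once its linear part at [b] is subtracted, [u] has partial derivatives of size at most [e] near
    [b], and [partials_lipschitz] applies. This is total differentiability at [b], obtained from
    continuous partial derivatives. *)
Lemma C1_increment n (u : 'cV[R]_n -> R) (b : 'cV[R]_n) (e : R) :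
  C1_at u b -> 0 < e ->
  \forall y \near b, `|u y - u b - \sum_k (y k ord0 - b k ord0) * 'D_(evec R k) u b|
     <= e * \sum_k `|y k ord0 - b k ord0|.
Proof.
move=> du e0.
have : \forall y \near b, forall k : 'I_n, derivable u y (evec R k) /\
    `|'D_(evec R k) u b - 'D_(evec R k) u y| <= e.
  apply: (near_forall (P := fun k y => derivable u y (evec R k) /\
    `|'D_(evec R k) u b - 'D_(evec R k) u y| <= e)) => k.
  have [d c] := du k.
  move/cvgrPdist_le : c => /(_ _ e0) c.
  by near=> y; split; near: y.
move=> /nbhs_ballP[r /= r0 H].
pose w y := u y - \sum_k (y k ord0) * 'D_(evec R k) u b.
have dl (y : 'cV[R]_n) k : is_derive y (evec R k)
    (fun y => \sum_k (y k ord0) * 'D_(evec R k) u b) ('D_(evec R k) u b).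
  have -> : (fun y : 'cV[R]_n => \sum_k (y k ord0) * 'D_(evec R k) u b) =
      \sum_k (fun y : 'cV[R]_n => (y k ord0) * 'D_(evec R k) u b).
    by apply/funext => z; rewrite fct_sumE.
  have dc l : is_derive y (evec R k)
     (fun y : 'cV[R]_n => (y l ord0) * 'D_(evec R l) u b)
     ((l == k)%:R * 'D_(evec R l) u b).
    have cv : (fun h : R => h^-1 *:
        ((h *: evec R k + y) l ord0 * 'D_(evec R l) u b -
         y l ord0 * 'D_(evec R l) u b)) @ 0^' -->
       (l == k)%:R * 'D_(evec R l) u b.
      apply: cvg_near_cst; near=> h.
      rewrite !mxE eqxx andbT mulrDl addrK -!mulrA [_ *: _]mulrA mulVf ?mul1r//.
      by near: h; exact: nbhs_dnbhs_neq.
    by split; [apply/cvg_ex; eexists; exact: cv|exact: cvg_lim].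
  have := is_derive_sum (fun l => dc l).
  move=> /is_derive_eq; apply.
  rewrite (bigD1 k)//= eqxx mul1r big1 ?addr0// => l lk.
  by rewrite (negbTE lk) mul0r.
near=> y.
have -> : u y - u b - \sum_k (y k ord0 - b k ord0) * 'D_(evec R k) u b = w y - w b.
  by rewrite /w; under eq_bigr do rewrite mulrBl; rewrite sumrB; ring.
apply: (@partials_lipschitz _ w b r).
  move=> z /H /= dz k; have [d1 d2] := dz k.
  have dw : is_derive z (evec R k) w ('D_(evec R k) u z - 'D_(evec R k) u b).
    exact: (is_deriveB (derivableP d1) (dl z k)).
  by split; [case: dw|rewrite derive_val distrC].
by near: y; apply/nbhs_ballP; exists r.
Unshelve. all: by end_near. Qed.

Lemma derivable_line_cvg (V : normedModType R) (g : V -> R) (a v : V) :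
  derivable g a v -> g (h *: v + a) @[h --> (0 : R)^'] --> g a.
Proof.
move=> dg.
have /differentiable_continuous : differentiable (fun h : R => g (h *: v + a)) 0.
  exact/derivable1_diffP/(derivable1P _ _ _).1.
by move=> /continuous_withinNx; rewrite scale0r add0r.
Qed.

(** The first-order expansion of [u] at [g a] is evaluated along the line. Its error is at most a
    small multiple of the increments of the components of [g], and these stay bounded after division
    by [h]. *)
Lemma is_derive_chain n (V : normedModType R) (u : 'cV[R]_n -> R)
    (g : V -> 'cV[R]_n) (a v : V) :
  C1_at u (g a) -> (forall k, derivable (fun x => g x k ord0) a v) ->
  is_derive a v (u \o g)
    (\sum_k 'D_(evec R k) u (g a) * 'D_v (fun x => g x k ord0) a).
Proof.
move=> du dg.
pose q k (h : R) := h^-1 *: (g (h *: v + a) k ord0 - g a k ord0).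
have cq k : q k h @[h --> 0^'] --> 'D_v (fun x => g x k ord0) a by exact: dg.
have cs : \sum_k 'D_(evec R k) u (g a) * q k h @[h --> 0^'] -->
    \sum_k 'D_(evec R k) u (g a) * 'D_v (fun x => g x k ord0) a.
  apply: cvg_big => [|k _]; first exact: add_continuous.
  by apply: cvgM => //; exact: cvg_cst.
have cg : g (h *: v + a) @[h --> 0^'] --> g a.
  apply/cvg_ballP => e e0.
  have : \forall h \near 0^', forall k : 'I_n,
      `|g a k ord0 - g (h *: v + a) k ord0| < e.
    apply: filter_forall => k.
    by move/cvgrPdist_lt : (derivable_line_cvg (dg k)) => /(_ _ e0).
  move=> H; near=> h; split => // i j; rewrite ord1 /ball/=.
  by move: i; near: h.
suff cv : h^-1 *: (u (g (h *: v + a)) - u (g a)) @[h --> 0^'] -->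
   \sum_k 'D_(evec R k) u (g a) * 'D_v (fun x => g x k ord0) a.
  by split; [apply/cvg_ex; eexists; exact: cv|exact: cvg_lim cv].
apply: cvg_sub0 cs.
apply/cvgr0Pnorm_le => e e0.
(* Near 0 each difference quotient is within 1 of its limit, so [K] bounds the sum of their absolute
   values. *)
pose K := \sum_k (`|'D_v (fun x => g x k ord0) a| + 1).
have K0 : 0 <= K by apply: sumr_ge0 => k _; rewrite addr_ge0.
have qK : \forall h \near 0^', \sum_k `|q k h| <= K.
  have : \forall h \near 0^', forall k, `|q k h| <= `|'D_v (fun x => g x k ord0) a| + 1.
    apply: filter_forall => k.
    move/cvgrPdist_le : (cq k) => /(_ 1 ltr01) H.
    near=> h; rewrite -lerBlDl; apply: le_trans (lerB_dist _ _) _.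
    by rewrite distrC; near: h.
  by apply: filterS => h H; apply: ler_sum.
(* [K] is an empty sum when [n = 0], so the division is by [K + 1]. *)
have e'0 : 0 < e / (K + 1) by rewrite divr_gt0// ltr_wpDl.
have inc := cg _ (C1_increment du e'0).
near=> h.
have h0 : h != 0 by near: h; exact: nbhs_dnbhs_neq.
have Es : \sum_k 'D_(evec R k) u (g a) * q k h =
    h^-1 * \sum_k (g (h *: v + a) k ord0 - g a k ord0) * 'D_(evec R k) u (g a).
  by rewrite mulr_sumr; apply: eq_bigr => k _; rewrite mulrC -mulrA.
rewrite !fctE Es -[_ *: _]/(h^-1 * _) -mulrBr normrM.
apply: (@le_trans _ _ (`|h^-1| *
    (e / (K + 1) * \sum_k `|g (h *: v + a) k ord0 - g a k ord0|))).
  by rewrite ler_wpM2l//; near: h.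
rewrite mulrCA mulr_sumr.
apply: (@le_trans _ _ (e / (K + 1) * K)).
  rewrite ler_wpM2l//; first exact: ltW.
  under eq_bigr do rewrite -normrM.
  by near: h; exact: qK.
by rewrite -mulrA ler_piMr ?(ltW e0)// [_^-1 * _]mulrC ler_pdivrMr ?ltr_wpDl// mul1r lerDl.
Unshelve. all: by end_near. Qed.

(* Both mixed partials are limits of the same second difference quotient. *)
Lemma second_difference (V : normedModType R) (u : V -> R) (x v w : V) (h : R) :
  (forall s t : R, `|s| <= `|h| -> `|t| <= `|h| ->
     derivable u (x + s *: v + t *: w) v /\
     derivable ('D_v u) (x + s *: v + t *: w) w) ->
  exists s t : R, [/\ `|s| <= `|h|, `|t| <= `|h| &
    (u (x + h *: v + h *: w) - u (x + h *: v)) - (u (x + h *: w) - u x)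
      = h * (h * 'D_w ('D_v u) (x + s *: v + t *: w))].
Proof.
move=> du.
pose psi y := u (y + h *: w) - u y.
have E y : is_derive y v (u \o shift (h *: w)) ('D_v u (y + h *: w)) <->
   derivable u (y + h *: w) v.
  have G : (fun k : R => k^-1 *:
      ((u \o shift (h *: w)) (k *: v + y) - (u \o shift (h *: w)) y))
     = (fun k : R => k^-1 *: (u (k *: v + (y + h *: w)) - u (y + h *: w))).
    by apply/funext => k /=; rewrite addrA.
  split; first by case; rewrite /derivable /= G.
  by move=> d; split; rewrite ?/derivable ?/derive /= G.
have dpsi (s : R) : `|s| <= `|h| -> is_derive (x + s *: v) v psi
    ('D_v u (x + s *: v + h *: w) - 'D_v u (x + s *: v)).
  move=> sh; have [d1 _] := du s h sh (lexx _).
  have [|d2 _] := du s 0 sh; first by rewrite normr0.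
  rewrite scale0r addr0 in d2.
  exact: (is_deriveB ((E _).2 d1) (derivableP d2)).
have [s sh] : exists2 s : R, `|s| <= `|h| &
    psi (x + h *: v) - psi x = h * 'D_v psi (x + s *: v).
  by apply: (@MVT_line _ psi x v h) => s sh; case: (dpsi s sh).
have [t th] : exists2 t : R, `|t| <= `|h| &
    'D_v u (x + s *: v + h *: w) - 'D_v u (x + s *: v) =
    h * 'D_w ('D_v u) (x + s *: v + t *: w).
  by apply: (@MVT_line _ ('D_v u) (x + s *: v) w h) => t th; case: (du s t sh th).
move=> Et Es; exists s, t; split => //.
by rewrite -Et; have <- := @derive_val _ _ _ _ _ _ _ (dpsi s sh).
Qed.

Lemma near_square (V : normedModType R) (P : V -> Prop) (x v w : V) :
  (\forall y \near x, P y) -> exists2 d : R, 0 < d &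
  forall s t : R, `|s| <= d -> `|t| <= d -> P (x + s *: v + t *: w).
Proof.
move=> /nbhs_ballP[e /= e0 He].
have K0 : 0 < `|v| + `|w| + 1 by rewrite ltr_wpDl// addr_ge0.
exists (e / 2 / (`|v| + `|w| + 1)); first by rewrite !divr_gt0.
move=> s t sd td; apply: He.
rewrite -ball_normE /ball_/= -addrA opprD addrA subrr sub0r normrN.
apply: le_lt_trans (ler_normD _ _) _; rewrite !normrZ.
apply: (@le_lt_trans _ _ (e / 2 / (`|v| + `|w| + 1) * (`|v| + `|w|))).
  by rewrite mulrDr lerD// ler_wpM2r.
apply: (@le_lt_trans _ _ (e / 2)); last by rewrite ltr_pdivrMr// ltr_pMr// ltr1n.
rewrite -mulrA ler_piMr ?divr_ge0 ?ltW// mulrC ltr_pdivrMr// mul1r ltrDl//.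
Qed.

Lemma Schwarz (V : normedModType R) (u : V -> R) (x v w : V) :
  (\forall y \near x, [/\ derivable u y v, derivable u y w,
     derivable ('D_v u) y w & derivable ('D_w u) y v]) ->
  {for x, continuous ('D_w ('D_v u))} -> {for x, continuous ('D_v ('D_w u))} ->
  'D_w ('D_v u) x = 'D_v ('D_w u) x.
Proof.
move=> du c1 c2; apply/eqP; rewrite -subr_eq0 -normr_le0.
apply/ler_addgt0Pr => e e0; rewrite add0r.
have e20 : 0 < e / 2 by rewrite divr_gt0.
have : \forall y \near x, [/\ derivable u y v, derivable u y w,
     derivable ('D_v u) y w & derivable ('D_w u) y v] /\
   (`|'D_w ('D_v u) x - 'D_w ('D_v u) y| <= e / 2 /\
    `|'D_v ('D_w u) x - 'D_v ('D_w u) y| <= e / 2).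
  move/cvgrPdist_le : c1 => /(_ _ e20) c1.
  move/cvgrPdist_le : c2 => /(_ _ e20) c2.
  exact: filterS3 (fun y a b c => conj a (conj b c)) du c1 c2.
move=> /(near_square v w)[h h0 H].
have hh : `|h| = h by rewrite gtr0_norm.
have [|s [t [sh th E1]]] := @second_difference _ u x v w h.
  by rewrite hh => s t sh th; have [[]] := H s t sh th.
have [|s' [t' [sh' th' E2]]] := @second_difference _ u x w v h.
  rewrite hh => s' t' sh' th'; have [[_ d2 _ d4] _] := H t' s' th' sh'.
  rewrite addrAC in d2; rewrite addrAC in d4.
  exact: (conj d2 d4).
rewrite hh in sh th sh' th'.
have [_ [b1 _]] := H s t sh th.
have [_ [_ b2]] := H t' s' th' sh'.
rewrite addrAC in b2.
have E : 'D_w ('D_v u) (x + s *: v + t *: w) = 'D_v ('D_w u) (x + s' *: w + t' *: v).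
  have hn : h != 0 by rewrite gt_eqF.
  apply: (mulfI hn); apply: (mulfI hn).
  refine (etrans (esym E1) (etrans _ E2)).
  by rewrite [x + h *: w + _]addrAC; ring.
rewrite E in b1.
rewrite -(subrKA ('D_v ('D_w u) (x + s' *: w + t' *: v))).
apply: le_trans (ler_normD _ _) _.
by rewrite [e]splitr; apply: lerD; [exact: b1|rewrite distrC; exact: b2].
Unshelve. all: by end_near. Qed.

End CalculusRn.

Lemma near_eq_continuous (T U : topologicalType) (u v : T -> U) (x : T) :
  (\forall y \near x, u y = v y) -> {for x, continuous u} ->
  {for x, continuous v}.
Proof.
move=> uv c; rewrite /prop_for /continuous_at -(nbhs_singleton uv).
by apply: cvg_trans c; exact: near_eq_cvg.
Qed.

(** * Functions of class C^k and smooth germs *)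

Section CkTheory.
Context {R : realType} {n : nat}.
Implicit Types (A B : set 'cV[R]_n) (u v : 'cV[R]_n -> R) (x : 'cV[R]_n).

Lemma Ck_continuous k A u x : Ck k A u -> A x -> {for x, continuous u}.
Proof. by case: k => [|k] [c _] /c. Qed.

Lemma Ck_sub k A B u : A `<=` B -> Ck k B u -> Ck k A u.
Proof.
elim: k u => [|k IH] u AB [c d]; split; try by move=> x /AB /c.
  by [].
by move=> i; have [d1 d2] := d i; split; [move=> x /AB /d1|exact: IH AB d2].
Qed.

Lemma Ck_eq k A u v : open A -> (forall x, A x -> u x = v x) ->
  Ck k A u -> Ck k A v.
Proof.
move=> oA; elim: k u v => [|k IH] u v uv [c d].
all: have nuv x : A x -> \forall y \near x, u y = v y by
  move=> Ax; apply: filterS uv _; exact: open_nbhs_nbhs.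
all: split.
1,3: by move=> x Ax; apply: near_eq_continuous (nuv x Ax) (c x Ax).
  by [].
move=> i; have [d1 d2] := d i; split.
  by move=> x Ax; apply: near_eq_derivable (d1 _ Ax); exact: nuv.
by apply: IH d2 => x Ax; apply: near_eq_derive; exact: nuv.
Qed.

Lemma Ck_pred k A u : Ck k.+1 A u -> Ck k A u.
Proof.
elim: k u => [|k IH] u [c d]; first by split.
by split=> // i; have [d1 d2] := d i; split => //; exact: IH.
Qed.

Lemma Ck_local k A u :
  (forall x, A x -> exists2 B, open_nbhs x B & Ck k B u) -> Ck k A u.
Proof.
elim: k u => [|k IH] u H; split.
- by move=> x /H[B [_ Bx] [c _]]; exact: c.
- by [].
- by move=> x /H[B [_ Bx] [c _]]; exact: c.
- move=> i; split; first by move=> x /H[B [_ Bx] [_ /(_ i)[d _]]]; exact: d.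
  by apply: IH => x /H[B oB [_ /(_ i)[_ d]]]; exists B.
Qed.

Lemma Ck_cst k A (c : R) : Ck k A (fun=> c).
Proof.
elim: k c => [|k IH] c; split.
- by move=> x _; exact: cst_continuous.
- by [].
- by move=> x _; exact: cst_continuous.
move=> i; split; first by move=> x _; exact: (derivable_cst c x).
suff -> : 'D_(evec R i) (fun=> c) = fun=> 0 by exact: IH.
by apply/funext => x; rewrite derive_cst.
Qed.

Lemma CkD k A u v : open A -> Ck k A u -> Ck k A v ->
  Ck k A (fun x => u x + v x).
Proof.
move=> oA; elim: k u v => [|k IH] u v [c d] [c' d']; split => //.
- by move=> x Ax; apply: continuousD; [exact: c|exact: c'].
- by move=> x Ax; apply: continuousD; [exact: c|exact: c'].
move=> i; have [d1 d2] := d i; have [d1' d2'] := d' i; split.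
  by move=> x Ax; apply: derivableD; [exact: d1|exact: d1'].
apply: (Ck_eq oA _ (IH _ _ d2 d2')) => x Ax.
by rewrite (deriveD (d1 _ Ax) (d1' _ Ax)).
Qed.

Lemma CkM k A u v : open A -> Ck k A u -> Ck k A v ->
  Ck k A (fun x => u x * v x).
Proof.
move=> oA; elim: k u v => [|k IH] u v Cu Cv.
  case: Cu Cv => [c d] [c' d']; split => // x Ax.
  by apply: continuousM; [exact: c|exact: c'].
case: (Cu) (Cv) => [c d] [c' d']; split => //.
  by move=> x Ax; apply: continuousM; [exact: c|exact: c'].
move=> i; have [d1 d2] := d i; have [d1' d2'] := d' i; split.
  by move=> x Ax; apply: derivableM; [exact: d1|exact: d1'].
apply: (Ck_eq oA _
  (CkD oA (IH _ _ (Ck_pred Cu) d2') (IH _ _ (Ck_pred Cv) d2))) => x Ax.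
by rewrite (deriveM (d1 _ Ax) (d1' _ Ax)).
Qed.

(** The derivative of 1/u is - (1/u)^2 Du, so the induction hypothesis for 1/u itself gives one more
    order. *)
Lemma CkV k A u : open A -> (forall x, A x -> u x != 0) -> Ck k A u ->
  Ck k A (fun x => (u x)^-1).
Proof.
move=> oA u0; elim: k => [|k IH] Cu.
  by case: Cu => c d; split => // x Ax; apply: continuousV; [exact: u0|exact: c].
case: (Cu) => [c d]; split => //.
  by move=> x Ax; apply: continuousV; [exact: u0|exact: c].
move=> i; have [d1 d2] := d i; split.
  by move=> x Ax; apply: derivableV; [exact: u0|exact: d1].
have CV := IH (Ck_pred Cu).
apply: (Ck_eq oA _ (CkM oA (Ck_cst k A (-1)) (CkM oA (CkM oA CV CV) d2))) => x Ax.
rewrite (deriveV (u0 _ Ax) (d1 _ Ax)) -[_ *: _]/(_ * _) -exprVn expr2.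
by rewrite mulN1r mulNr.
Qed.

(** Smoothness of a germ, with one neighbourhood for all orders [k]. In this form it passes to sums,
    products and partial derivatives without any open set to carry along. *)
Definition Smooth u x : Prop := exists2 A, open_nbhs x A & forall k, Ck k A u.

Lemma Smooth_near u x : Smooth u x -> \forall y \near x, Smooth u y.
Proof.
by move=> [A [oA Ax] C]; apply: filterS (open_nbhs_nbhs (conj oA Ax)) => y Ay; exists A.
Qed.

Lemma Smooth_eq u v x : (\forall y \near x, u y = v y) -> Smooth u x -> Smooth v x.
Proof.
move=> uv [A [oA Ax] C].
have : nbhs x (A `&` [set y | u y = v y]).
  by apply: filterI => //; exact: open_nbhs_nbhs.
rewrite nbhsE => -[B [oB Bx] BA]; exists B => // k.
apply: (Ck_eq (u := u)) => // [y /BA[]//|].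
by apply: Ck_sub (C k) => y /BA[].
Qed.

Lemma Smooth_cst c x : Smooth (fun=> c) x.
Proof. by exists setT => [|k]; [split => //; exact: openT|exact: Ck_cst]. Qed.

Let open_nbhsI A B x : open_nbhs x A -> open_nbhs x B -> open_nbhs x (A `&` B).
Proof. by move=> [oA Ax] [oB Bx]; split => //; exact: openI. Qed.

Lemma SmoothD u v x : Smooth u x -> Smooth v x -> Smooth (fun x => u x + v x) x.
Proof.
move=> [A oA CA] [B oB CB]; exists (A `&` B); first exact: open_nbhsI.
move=> k; apply: CkD; first by case: (open_nbhsI oA oB).
  by apply: Ck_sub (CA k) => y [].
by apply: Ck_sub (CB k) => y [].
Qed.

Lemma SmoothM u v x : Smooth u x -> Smooth v x -> Smooth (fun x => u x * v x) x.
Proof.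
move=> [A oA CA] [B oB CB]; exists (A `&` B); first exact: open_nbhsI.
move=> k; apply: CkM; first by case: (open_nbhsI oA oB).
  by apply: Ck_sub (CA k) => y [].
by apply: Ck_sub (CB k) => y [].
Qed.

Lemma Smooth_continuous u x : Smooth u x -> {for x, continuous u}.
Proof. by move=> [A [oA Ax] C]; exact: Ck_continuous (C 0) Ax. Qed.

Lemma SmoothV u x : u x != 0 -> Smooth u x -> Smooth (fun x => (u x)^-1) x.
Proof.
move=> ux0 Su; have cu := Smooth_continuous Su; case: Su => [A [oA Ax] C].
have : nbhs x (A `&` [set y | u y != 0]).
  apply: filterI; first exact: open_nbhs_nbhs.
  by move/cvgr_neq0 : cu => /(_ ux0).
rewrite nbhsE => -[B [oB Bx] BA]; exists B => // k.
apply: CkV => // [y /BA[]//|].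
by apply: Ck_sub (C k) => y /BA[].
Qed.

Lemma Smooth_derivable u x k : Smooth u x -> derivable u x (evec R k).
Proof. by move=> [A [oA Ax] /(_ 1)[_ /(_ k)[d _]]]; exact: d. Qed.

Lemma Smooth_derive u x k : Smooth u x -> Smooth ('D_(evec R k) u) x.
Proof.
by move=> [A oA C]; exists A => // l; have [_ /(_ k)[]] := C l.+1.
Qed.

Lemma Smooth_C1_at u x : Smooth u x -> C1_at u x.
Proof.
move=> Su k; split; last exact/Smooth_continuous/Smooth_derive.
by apply: filterS (Smooth_near Su) => y; exact: Smooth_derivable.
Qed.

Lemma Smooth_Schwarz u x k l : Smooth u x ->
  'D_(evec R k) ('D_(evec R l) u) x = 'D_(evec R l) ('D_(evec R k) u) x.
Proof.
move=> Su; apply: Schwarz; last 2 first.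
- exact/Smooth_continuous/Smooth_derive/Smooth_derive.
- exact/Smooth_continuous/Smooth_derive/Smooth_derive.
apply: filterS (Smooth_near Su) => y Sy; split; apply: Smooth_derivable => //.
  exact: Smooth_derive.
exact: Smooth_derive.
Qed.

End CkTheory.

(** * Calculus in the charts of a manifold *)

Section ManifoldCalculus.
Context {R : realType} {n : nat} (M : manifold R n).
Implicit Types (i j : cidx M) (p : M) (u v w : M -> R).

Lemma chart_near i p (P : M -> Prop) : dom i p -> (\forall q \near p, P q) ->
  \forall y \near chart i p, P (chart_inv i y).
Proof.
move=> ip Pp.
have c : {for chart i p, continuous (chart_inv i)}.
  by apply: chart_inv_continuous; exists p.
by apply: c; rewrite chartK.
Qed.

Lemma near_chart i p (P : 'cV[R]_n -> Prop) : dom i p ->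
  (\forall y \near chart i p, P y) -> \forall q \near p, P (chart i q).
Proof. by move=> ip Pp; exact: (chart_continuous ip). Qed.

Lemma dom_near i p : dom i p -> \forall q \near p, dom i q.
Proof. by move=> ip; apply: open_nbhs_nbhs; split => //; exact: dom_open. Qed.

Lemma chart_image_near i p : dom i p ->
  \forall y \near chart i p, (chart i @` dom i) y.
Proof.
move=> ip; apply: open_nbhs_nbhs; split; first exact: chart_open.
by exists p.
Qed.

Lemma chart_invK_near i p : dom i p ->
  \forall y \near chart i p, chart i (chart_inv i y) = y.
Proof. by move=> /chart_image_near; apply: filterS => y [q iq <-]; rewrite chartK. Qed.

Lemma chart_image_open i (A : set M) : open A -> open (chart i @` (A `&` dom i)).
Proof.
move=> oA; rewrite openE => _ [p [Ap ip] <-]; rewrite /interior.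
have := chart_near ip (open_nbhs_nbhs (conj oA Ap)).
have := chart_image_near ip; apply: filterS2 => y [q iq <-].
by rewrite chartK// => Aq; exists q.
Qed.

(** Smoothness read in one fixed chart; [smooth_onP] relates it to [smooth_on], which quantifies
    over all charts. *)
Definition smooth_at i u p : Prop := Smooth (u \o chart_inv i) (chart i p).

Lemma smooth_onP (A : set M) u : open A ->
  smooth_on A u <-> forall i p, A p -> dom i p -> smooth_at i u p.
Proof.
move=> oA; split=> [Su i p Ap ip|Su i k].
  exists (chart i @` (A `&` dom i)); last by move=> k; exact: Su.
  by split; [exact: chart_image_open|exists p].
by apply: Ck_local => _ [p [Ap ip] <-]; have [B oB C] := Su i p Ap ip; exists B.
Qed.

Lemma smooth_at_eq i u v p : dom i p -> (\forall q \near p, u q = v q) ->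
  smooth_at i u p -> smooth_at i v p.
Proof. by move=> ip uv; apply: Smooth_eq; exact: (chart_near ip uv). Qed.

Lemma smooth_at_cst i c p : smooth_at i (fun=> c) p.
Proof. exact: Smooth_cst. Qed.

Lemma smooth_atD i u v p : smooth_at i u p -> smooth_at i v p ->
  smooth_at i (fun q => u q + v q) p.
Proof. exact: SmoothD. Qed.

Lemma smooth_atM i u v p : smooth_at i u p -> smooth_at i v p ->
  smooth_at i (fun q => u q * v q) p.
Proof. exact: SmoothM. Qed.

Lemma smooth_atN i u p : smooth_at i u p -> smooth_at i (fun q => - u q) p.
Proof.
move=> Su; apply: (Smooth_eq _ (SmoothM (Smooth_cst (-1) _) Su)).
by apply: filterE => y /=; rewrite mulN1r.
Qed.

Lemma smooth_atB i u v p : smooth_at i u p -> smooth_at i v p ->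
  smooth_at i (fun q => u q - v q) p.
Proof. by move=> Su Sv; apply: smooth_atD => //; exact: smooth_atN. Qed.

Lemma smooth_atV i u p : dom i p -> u p != 0 -> smooth_at i u p ->
  smooth_at i (fun q => (u q)^-1) p.
Proof. by move=> ip u0; apply: SmoothV => /=; rewrite chartK. Qed.

Lemma smooth_at_sum i p (I : Type) (r : seq I) (P : pred I) (F : I -> M -> R) :
  (forall k, smooth_at i (F k) p) ->
  smooth_at i (fun q => \sum_(k <- r | P k) F k q) p.
Proof.
move=> SF; elim: r => [|k r IH].
  by under [fun q => _]funext do rewrite big_nil; exact: smooth_at_cst.
under [fun q => _]funext do rewrite big_cons; case: (P k) => //.
exact: smooth_atD.
Qed.

Lemma smooth_at_prod i p (I : Type) (r : seq I) (P : pred I) (F : I -> M -> R) :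
  (forall k, smooth_at i (F k) p) ->
  smooth_at i (fun q => \prod_(k <- r | P k) F k q) p.
Proof.
move=> SF; elim: r => [|k r IH].
  by under [fun q => _]funext do rewrite big_nil; exact: smooth_at_cst.
under [fun q => _]funext do rewrite big_cons; case: (P k) => //.
exact: smooth_atM.
Qed.

Lemma smooth_at_pd i k u p : dom i p -> smooth_at i u p ->
  smooth_at i (pd i k u) p.
Proof.
move=> ip Su; apply: (Smooth_eq _ (Smooth_derive k Su)).
by have := chart_invK_near ip; apply: filterS => y E; rewrite /pd /= E.
Qed.

Lemma pd_eq i k u v p : dom i p -> (\forall q \near p, u q = v q) ->
  pd i k u p = pd i k v p.
Proof. by move=> ip uv; apply: near_eq_derive; exact: (chart_near ip uv). Qed.

Lemma pd_cst i k c p : pd i k (fun=> c) p = 0.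
Proof. exact: derive_cst. Qed.

Lemma pdD i k u v p : smooth_at i u p -> smooth_at i v p ->
  pd i k (fun q => u q + v q) p = pd i k u p + pd i k v p.
Proof.
move=> /(@Smooth_derivable _ _ _ _ k) du /(@Smooth_derivable _ _ _ _ k) dv.
exact: (deriveD du dv).
Qed.

Lemma pdM i k u v p : dom i p -> smooth_at i u p -> smooth_at i v p ->
  pd i k (fun q => u q * v q) p = u p * pd i k v p + pd i k u p * v p.
Proof.
move=> ip /(@Smooth_derivable _ _ _ _ k) du /(@Smooth_derivable _ _ _ _ k) dv.
by rewrite [LHS](deriveM du dv) /= chartK// [pd i k u p * _]mulrC.
Qed.

Lemma pd_Schwarz i k l u p : dom i p -> smooth_at i u p ->
  pd i k (pd i l u) p = pd i l (pd i k u) p.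
Proof.
move=> ip Su.
have E a b : pd i a (pd i b u) p =
    'D_(evec R a) ('D_(evec R b) (u \o chart_inv i)) (chart i p).
  apply: near_eq_derive.
  by have := chart_invK_near ip; apply: filterS => y E; rewrite /pd /= E.
by rewrite !E; exact: Smooth_Schwarz.
Qed.

Lemma dird_eq i x u v p : dom i p -> (\forall q \near p, u q = v q) ->
  dird i x u p = dird i x v p.
Proof. by move=> ip uv; apply: eq_bigr => k _; rewrite (pd_eq k ip uv). Qed.

Lemma dird_cst i x c p : dird i x (fun=> c) p = 0.
Proof. by rewrite /dird big1// => k _; rewrite pd_cst mulr0. Qed.

Lemma dirdD i x u v p : smooth_at i u p -> smooth_at i v p ->
  dird i x (fun q => u q + v q) p = dird i x u p + dird i x v p.
Proof.
by move=> Su Sv; rewrite /dird -big_split; apply: eq_bigr => k _;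
  rewrite pdD// mulrDr.
Qed.

Lemma dirdM i x u v p : dom i p -> smooth_at i u p -> smooth_at i v p ->
  dird i x (fun q => u q * v q) p = u p * dird i x v p + dird i x u p * v p.
Proof.
move=> ip Su Sv; rewrite /dird mulr_sumr mulr_suml -big_split.
by apply: eq_bigr => k _; rewrite pdM//=; ring.
Qed.

Lemma dirdN i x u p : dom i p -> smooth_at i u p ->
  dird i x (fun q => - u q) p = - dird i x u p.
Proof.
move=> ip Su; under [fun q => - u q]funext do rewrite -mulN1r.
by rewrite dirdM ?dird_cst ?mul0r ?addr0 ?mulN1r//; exact: smooth_at_cst.
Qed.

Lemma dird_sum i x p (I : Type) (r : seq I) (F : I -> M -> R) :
  (forall k, smooth_at i (F k) p) ->
  dird i x (fun q => \sum_(k <- r) F k q) p = \sum_(k <- r) dird i x (F k) p.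
Proof.
move=> SF; elim: r => [|k r IH].
  by under [fun q => _]funext do rewrite big_nil; rewrite dird_cst big_nil.
under [fun q => _]funext do rewrite big_cons.
by rewrite dirdD// ?IH ?big_cons//; exact: smooth_at_sum.
Qed.

(** Fields with constant components in a chart commute: expand both sides in second partial
    derivatives and apply [pd_Schwarz]. *)
Lemma dird_Schwarz i x y u p : dom i p -> smooth_at i u p ->
  dird i x (dird i y u) p = dird i y (dird i x u) p.
Proof.
have E a b : dom i p -> smooth_at i u p -> dird i a (dird i b u) p =
    \sum_k \sum_l a k ord0 * b l ord0 * pd i k (pd i l u) p.
  move=> ip Su; rewrite {1}/dird; under eq_bigr => k _.
    have -> : pd i k (dird i b u) p = \sum_l b l ord0 * pd i k (pd i l u) p.
      rewrite /dird.
      have S l : smooth_at i (fun q => b l ord0 * pd i l u q) p.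
        by apply: smooth_atM; [exact: smooth_at_cst|exact: smooth_at_pd].
      transitivity (\sum_l pd i k (fun q => b l ord0 * pd i l u q) p).
        elim: (index_enum _) => [|l r IH].
          by under [fun q => _]funext do rewrite big_nil; rewrite pd_cst big_nil.
        under [fun q => _]funext do rewrite big_cons.
        by rewrite pdD// ?IH ?big_cons//; exact: smooth_at_sum.
      apply: eq_bigr => l _; rewrite pdM//; last exact: smooth_at_pd.
        by rewrite pd_cst mul0r addr0.
      exact: smooth_at_cst.
    rewrite mulr_sumr; under eq_bigr do rewrite mulrA; over.
  by [].
move=> ip Su; rewrite !E// exchange_big /=; apply: eq_bigr => k _.
by apply: eq_bigr => l _; rewrite pd_Schwarz// [_ * x _ _]mulrC.
Qed.

Lemma locally_cst i u p : dom i p ->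
  (\forall q \near p, smooth_at i u q /\ forall k, pd i k u q = 0) ->
  \forall q \near p, u q = u p.
Proof.
move=> ip H.
have /nbhs_ballP[r /= r0 B] : \forall y \near chart i p,
    Smooth (u \o chart_inv i) y /\
    forall k, 'D_(evec R k) (u \o chart_inv i) y = 0.
  have := chart_near ip H; have := chart_invK_near ip.
  by apply: filterS2 => y E; rewrite /smooth_at /pd E.
have := near_chart ip (nbhsx_ballx _ _ r0).
have := dom_near ip; apply: filterS2 => q iq bq.
have := @zero_partials_cst _ _ (u \o chart_inv i) (chart i p) r.
move=> /(_ _ _ bq) /=; rewrite !chartK//; apply.
by move=> y /B [Sy dy] k; split; [exact: Smooth_derivable|exact: dy].
Qed.

End ManifoldCalculus.

(** * Matrix-valued and complex-valued functions *)

Section MatrixCalculus.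
Context {R : realType} {n : nat} (M : manifold R n).
Implicit Types (i j : cidx M) (p : M).

Definition smooth_mx_at a b i (A : M -> 'M[R]_(a, b)) p : Prop :=
  forall r s, smooth_at i (fun q => A q r s) p.

Definition dird_mx a b i x (A : M -> 'M[R]_(a, b)) p : 'M[R]_(a, b) :=
  \matrix_(r, s) dird i x (fun q => A q r s) p.

Lemma dird_cVE a i x (A : M -> 'cV[R]_a) p : dird_cV i x A p = dird_mx i x A p.
Proof. by apply/colP => r; rewrite [LHS]mxE [RHS]mxE. Qed.

Lemma smooth_mx_at_eq a b i (A B : M -> 'M[R]_(a, b)) p : dom i p ->
  (\forall q \near p, A q = B q) -> smooth_mx_at i A p -> smooth_mx_at i B p.
Proof.
move=> ip AB SA r s; apply: smooth_at_eq (SA r s) => //.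
by apply: filterS AB => q ->.
Qed.

Lemma smooth_mx_at_cst a b i (C : 'M[R]_(a, b)) p : smooth_mx_at i (fun=> C) p.
Proof. by move=> r s; exact: smooth_at_cst. Qed.

Lemma smooth_mx_at_tr a b i (A : M -> 'M[R]_(a, b)) p :
  smooth_mx_at i A p -> smooth_mx_at i (fun q => (A q)^T) p.
Proof. by move=> SA r s; under [fun q => _]funext do rewrite mxE; exact: SA. Qed.

Lemma smooth_mx_atM a b c i (A : M -> 'M[R]_(a, b)) (B : M -> 'M[R]_(b, c)) p :
  smooth_mx_at i A p -> smooth_mx_at i B p ->
  smooth_mx_at i (fun q => A q *m B q) p.
Proof.
move=> SA SB r s; under [fun q => _]funext do rewrite mxE.
by apply: smooth_at_sum => k; exact: smooth_atM.
Qed.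

Lemma smooth_at_det a i (A : M -> 'M[R]_a) p : smooth_mx_at i A p ->
  smooth_at i (fun q => \det (A q)) p.
Proof.
move=> SA; apply: smooth_at_sum => s; apply: smooth_atM.
  exact: smooth_at_cst.
exact: smooth_at_prod.
Qed.

(** Cramer's rule: where the matrix is invertible, its inverse is the adjugate divided by the
    determinant, and both are polynomial in the entries. *)
Lemma smooth_mx_at_inv a i (A : M -> 'M[R]_a) p : dom i p ->
  (\forall q \near p, A q \in unitmx) -> smooth_mx_at i A p ->
  smooth_mx_at i (fun q => invmx (A q)) p.
Proof.
move=> ip uA SA.
apply: (@smooth_mx_at_eq _ _ _ (fun q => (\det (A q))^-1 *: \adj (A q))) => //.
  by apply: filterS uA => q uq; rewrite /invmx uq.
move=> r s; under [fun q => _]funext do rewrite !mxE.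
apply: smooth_atM.
  apply: smooth_atV (smooth_at_det SA) => //.
  by have := nbhs_singleton uA; rewrite unitmxE unitfE.
apply: smooth_atM; first exact: smooth_at_cst.
apply: smooth_at_det => k l; under [fun q => _]funext do rewrite !mxE.
exact: SA.
Qed.

Lemma dird_mx_eq a b i x (A B : M -> 'M[R]_(a, b)) p : dom i p ->
  (\forall q \near p, A q = B q) -> dird_mx i x A p = dird_mx i x B p.
Proof.
move=> ip AB; apply/matrixP => r s; rewrite !mxE; apply: dird_eq => //.
by apply: filterS AB => q ->.
Qed.

Lemma dird_mx_cst a b i x (C : 'M[R]_(a, b)) p : dird_mx i x (fun=> C) p = 0.
Proof. by apply/matrixP => r s; rewrite !mxE dird_cst. Qed.

Lemma dird_mx_tr a b i x (A : M -> 'M[R]_(a, b)) p :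
  dird_mx i x (fun q => (A q)^T) p = (dird_mx i x A p)^T.
Proof.
apply/matrixP => r s; rewrite !mxE.
by under [fun q => _]funext do rewrite mxE.
Qed.

Lemma dird_mxD a b i x (A B : M -> 'M[R]_(a, b)) p :
  smooth_mx_at i A p -> smooth_mx_at i B p ->
  dird_mx i x (fun q => A q + B q) p = dird_mx i x A p + dird_mx i x B p.
Proof.
move=> SA SB; apply/matrixP => r s; rewrite !mxE.
by under [fun q => _]funext do rewrite mxE; exact: dirdD.
Qed.

Lemma dird_mxM a b c i x (A : M -> 'M[R]_(a, b)) (B : M -> 'M[R]_(b, c)) p :
  dom i p -> smooth_mx_at i A p -> smooth_mx_at i B p ->
  dird_mx i x (fun q => A q *m B q) p
    = A p *m dird_mx i x B p + dird_mx i x A p *m B p.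
Proof.
move=> ip SA SB; apply/matrixP => r s; rewrite !mxE.
under [fun q => _]funext do rewrite mxE.
rewrite dird_sum => [|k]; last exact: smooth_atM.
rewrite -big_split; apply: eq_bigr => k _ /=; rewrite !mxE.
exact: dirdM.
Qed.

Lemma dird_mx_Schwarz a b i x y (A : M -> 'M[R]_(a, b)) p : dom i p ->
  smooth_mx_at i A p ->
  dird_mx i x (dird_mx i y A) p = dird_mx i y (dird_mx i x A) p.
Proof.
move=> ip SA; apply/matrixP => r s; rewrite !mxE.
have E z : (fun q => dird_mx i z A q r s) = dird i z (fun q => A q r s).
  by apply/funext => q; rewrite mxE.
by rewrite !E dird_Schwarz.
Qed.

Local Notation C := (complex R).

Definition csmooth_at i (u : M -> C) p : Prop :=
  smooth_at i (fun q => complex.Re (u q)) p /\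
  smooth_at i (fun q => complex.Im (u q)) p.

Definition csmooth_mx_at a b i (A : M -> 'M[C]_(a, b)) p : Prop :=
  forall r s, csmooth_at i (fun q => A q r s) p.

Definition cdird i x (u : M -> C) p : C :=
  Complex (dird i x (fun q => complex.Re (u q)) p)
          (dird i x (fun q => complex.Im (u q)) p).

Lemma dird_mxCE a b i x (A : M -> 'M[C]_(a, b)) p r s :
  dird_mxC i x A p r s = cdird i x (fun q => A q r s) p.
Proof. by rewrite mxE. Qed.

Let ReD (x y : C) : complex.Re (x + y) = complex.Re x + complex.Re y.
Proof. by case: x y => [? ?] []. Qed.
Let ImD (x y : C) : complex.Im (x + y) = complex.Im x + complex.Im y.
Proof. by case: x y => [? ?] []. Qed.
Let ReM (x y : C) : complex.Re (x * y) =
  complex.Re x * complex.Re y - complex.Im x * complex.Im y.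
Proof. by case: x y => [? ?] []. Qed.
Let ImM (x y : C) : complex.Im (x * y) =
  complex.Re x * complex.Im y + complex.Im x * complex.Re y.
Proof. by case: x y => [? ?] []. Qed.

Lemma csmooth_atD i (u v : M -> C) p : csmooth_at i u p -> csmooth_at i v p ->
  csmooth_at i (fun q => u q + v q) p.
Proof.
move=> [u1 u2] [v1 v2]; split.
  by under [fun q => _]funext do rewrite ReD; exact: smooth_atD.
by under [fun q => _]funext do rewrite ImD; exact: smooth_atD.
Qed.

Lemma csmooth_atM i (u v : M -> C) p : csmooth_at i u p -> csmooth_at i v p ->
  csmooth_at i (fun q => u q * v q) p.
Proof.
move=> [u1 u2] [v1 v2]; split.
  by under [fun q => _]funext do rewrite ReM; apply: smooth_atB; exact: smooth_atM.
by under [fun q => _]funext do rewrite ImM; apply: smooth_atD; exact: smooth_atM.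
Qed.

Lemma csmooth_at_cst i c p : csmooth_at i (fun=> c) p.
Proof. by split; exact: smooth_at_cst. Qed.

Lemma csmooth_at_real i (u : M -> R) p : smooth_at i u p ->
  csmooth_at i (fun q => real_complex R (u q)) p.
Proof. by move=> Su; split => //=; exact: smooth_at_cst. Qed.

Lemma csmooth_at_sum i p (I : Type) (r : seq I) (F : I -> M -> C) :
  (forall k, csmooth_at i (F k) p) ->
  csmooth_at i (fun q => \sum_(k <- r) F k q) p.
Proof.
move=> SF; elim: r => [|k r IH].
  by under [fun q => _]funext do rewrite big_nil; exact: csmooth_at_cst.
by under [fun q => _]funext do rewrite big_cons; exact: csmooth_atD.
Qed.

Lemma csmooth_mx_atM a b c i (A : M -> 'M[C]_(a, b)) (B : M -> 'M[C]_(b, c)) p :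
  csmooth_mx_at i A p -> csmooth_mx_at i B p ->
  csmooth_mx_at i (fun q => A q *m B q) p.
Proof.
move=> SA SB r s; under [fun q => _]funext do rewrite mxE.
by apply: csmooth_at_sum => k; exact: csmooth_atM.
Qed.

Lemma csmooth_mx_at_cst a b i (A : 'M[C]_(a, b)) p : csmooth_mx_at i (fun=> A) p.
Proof. by move=> r s; exact: csmooth_at_cst. Qed.

Lemma csmooth_mx_at_real a b i (A : M -> 'M[R]_(a, b)) p : smooth_mx_at i A p ->
  csmooth_mx_at i (fun q => map_mx (real_complex R) (A q)) p.
Proof.
move=> SA r s; under [fun q => _]funext do rewrite mxE.
exact: csmooth_at_real.
Qed.

Lemma csmooth_mx_at_tr a b i (A : M -> 'M[C]_(a, b)) p :
  csmooth_mx_at i A p -> csmooth_mx_at i (fun q => (A q)^T) p.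
Proof. by move=> SA r s; under [fun q => _]funext do rewrite mxE; exact: SA. Qed.

Lemma csmooth_mx_at_sum a b i p (I : Type) (t : seq I)
    (F : I -> M -> 'M[C]_(a, b)) :
  (forall k, csmooth_mx_at i (F k) p) ->
  csmooth_mx_at i (fun q => \sum_(k <- t) F k q) p.
Proof.
move=> SF r s; under [fun q => _]funext do rewrite summxE.
by apply: csmooth_at_sum => k; exact: SF.
Qed.

Lemma cdirdD i x (u v : M -> C) p : csmooth_at i u p -> csmooth_at i v p ->
  cdird i x (fun q => u q + v q) p = cdird i x u p + cdird i x v p.
Proof.
move=> [u1 u2] [v1 v2]; rewrite /cdird.
under [fun q => complex.Re _]funext do rewrite ReD.
under [fun q => complex.Im _]funext do rewrite ImD.
by rewrite !dirdD.
Qed.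

Lemma cdird_cst i x c p : cdird i x (fun=> c) p = 0.
Proof. by rewrite /cdird !dird_cst. Qed.

Lemma cdirdM i x (u v : M -> C) p : dom i p -> csmooth_at i u p ->
  csmooth_at i v p ->
  cdird i x (fun q => u q * v q) p = u p * cdird i x v p + cdird i x u p * v p.
Proof.
move=> ip [u1 u2] [v1 v2]; rewrite /cdird.
under [fun q => complex.Re _]funext do rewrite ReM.
under [fun q => complex.Im _]funext do rewrite ImM.
rewrite dirdD ?dirdN ?dirdD ?dirdM//; try exact: smooth_atM.
  by case: (u p) (v p) => [a b] [c d] /=; congr Complex; ring.
by apply: smooth_atN; exact: smooth_atM.
Qed.

Lemma cdird_sum i x p (I : Type) (r : seq I) (F : I -> M -> C) :
  (forall k, csmooth_at i (F k) p) ->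
  cdird i x (fun q => \sum_(k <- r) F k q) p = \sum_(k <- r) cdird i x (F k) p.
Proof.
move=> SF; elim: r => [|k r IH].
  by under [fun q => _]funext do rewrite big_nil; rewrite cdird_cst big_nil.
under [fun q => _]funext do rewrite big_cons.
by rewrite cdirdD// ?IH ?big_cons//; exact: csmooth_at_sum.
Qed.

Lemma dird_mxC_sum a b i x p (I : Type) (t : seq I) (F : I -> M -> 'M[C]_(a, b)) :
  (forall k, csmooth_mx_at i (F k) p) ->
  dird_mxC i x (fun q => \sum_(k <- t) F k q) p = \sum_(k <- t) dird_mxC i x (F k) p.
Proof.
move=> SF; apply/matrixP => r s; rewrite summxE dird_mxCE.
under [fun q => _]funext do rewrite summxE.
rewrite cdird_sum => [|k]; last exact: SF.
by apply: eq_bigr => k _; rewrite dird_mxCE.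
Qed.

Lemma dird_mxC_M a b c i x (A : M -> 'M[C]_(a, b)) (B : M -> 'M[C]_(b, c)) p :
  dom i p -> csmooth_mx_at i A p -> csmooth_mx_at i B p ->
  dird_mxC i x (fun q => A q *m B q) p
    = A p *m dird_mxC i x B p + dird_mxC i x A p *m B p.
Proof.
move=> ip SA SB; apply/matrixP => r s; rewrite dird_mxCE !mxE.
under [fun q => _]funext do rewrite mxE.
rewrite cdird_sum => [|k]; last exact: csmooth_atM.
rewrite -big_split; apply: eq_bigr => k _ /=; rewrite !dird_mxCE.
exact: cdirdM.
Qed.

Lemma dird_mxC_cst a b i x (A : 'M[C]_(a, b)) p : dird_mxC i x (fun=> A) p = 0.
Proof. by apply/matrixP => r s; rewrite dird_mxCE cdird_cst mxE. Qed.

Lemma dird_mxC_real a b i x (A : M -> 'M[R]_(a, b)) p :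
  dird_mxC i x (fun q => map_mx (real_complex R) (A q)) p
    = map_mx (real_complex R) (dird_mx i x A p).
Proof.
apply/matrixP => r s; rewrite dird_mxCE !mxE /cdird.
under [fun q => _]funext do rewrite mxE /=.
by under [fun q => complex.Im _]funext do rewrite mxE /=; rewrite dird_cst.
Qed.

Lemma dird_mxC_tr a b i x (A : M -> 'M[C]_(a, b)) p :
  dird_mxC i x (fun q => (A q)^T) p = (dird_mxC i x A p)^T.
Proof.
apply/matrixP => r s; rewrite [RHS]mxE !dird_mxCE.
by under [fun q => _]funext do rewrite mxE.
Qed.

Lemma dird_mxC_eq a b i x (A B : M -> 'M[C]_(a, b)) p : dom i p ->
  (\forall q \near p, A q = B q) -> dird_mxC i x A p = dird_mxC i x B p.
Proof.
move=> ip AB; apply/matrixP => r s; rewrite !dird_mxCE /cdird.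
by congr Complex; apply: dird_eq => //; apply: filterS AB => q ->.
Qed.

End MatrixCalculus.

(** * The chain rule for maps between manifolds, and Jacobians *)

Section ChainRule.
Context {R : realType} {m n : nat} (M : manifold R m) (N : manifold R n).

(** The Euclidean chain rule applied to the coordinate expression [g] of [f]. With [f] the identity
    it gives the change of chart on one manifold, and with [u] a coordinate of N the change of chart
    in the target. *)
Lemma pd_comp (f : M -> N) (i : cidx M) (j : cidx N) k (u : N -> R) p :
  dom i p -> dom j (f p) -> {for p, continuous f} ->
  (forall c, smooth_at i (fun q => chart j (f q) c ord0) p) ->
  smooth_at j u (f p) ->
  pd i k (u \o f) p =
    \sum_c pd j c u (f p) * pd i k (fun q => chart j (f q) c ord0) p.
Proof.
move=> ip jp cf Sf Su.
pose g x := chart j (f (chart_inv i x)).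
have Eg : g (chart i p) = chart j (f p) by rewrite /g chartK.
have E : pd i k (u \o f) p = 'D_(evec R k) ((u \o chart_inv j) \o g) (chart i p).
  apply: near_eq_derive.
  have H : \forall q \near p, dom j (f q) by exact: (cf _ (dom_near jp)).
  by have := chart_near ip H; apply: filterS => x jx; rewrite /g /= chartK.
rewrite E.
have d : C1_at (u \o chart_inv j) (g (chart i p)).
  by rewrite Eg; exact: Smooth_C1_at.
have dg c : derivable (fun x => g x c ord0) (chart i p) (evec R k).
  exact: Smooth_derivable (Sf c).
have D := is_derive_chain d dg.
by rewrite derive_val Eg.
Qed.

End ChainRule.

Section Jacobians.
Context {R : realType} {m : nat} (M : manifold R m).
Implicit Types (i j k : cidx M) (p : M).

Lemma smooth_at_chart i j c p : dom i p -> dom j p ->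
  smooth_at i (fun q => chart j q c ord0) p.
Proof.
move=> ip jp; exists (chart i @` (dom i `&` dom j)).
  split; last by exists p.
  by rewrite setIC; apply: chart_image_open; exact: dom_open.
by move=> k; exact: chart_smooth.
Qed.

Lemma pd_change i j (k : 'I_m) (u : M -> R) p : dom i p -> dom j p -> smooth_at j u p ->
  pd i k u p = \sum_c pd j c u p * jac i j p c k.
Proof.
move=> ip jp Su; rewrite [LHS](@pd_comp _ _ _ _ _ id i j k u p)//.
  by apply: eq_bigr => c _; rewrite mxE.
by move=> c; exact: smooth_at_chart.
Qed.

Lemma jac_trans i j k p : dom i p -> dom j p -> dom k p ->
  jac i k p = jac j k p *m jac i j p.
Proof.
move=> ip jp kp; apply/matrixP => a b; rewrite !mxE (pd_change _ ip jp).
  by apply: eq_bigr => c _; rewrite !mxE.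
exact: smooth_at_chart.
Qed.

Lemma jac_id i p : dom i p -> jac i i p = 1%:M.
Proof.
move=> ip; apply/matrixP => a b; rewrite !mxE /pd.
transitivity ('D_(evec R b) (fun x : 'cV[R]_m => x a ord0) (chart i p)).
  apply: near_eq_derive; have := chart_invK_near ip.
  by apply: filterS => x /= ->.
apply: cvg_lim => //; apply: cvg_near_cst.
apply: filterS (nbhs_dnbhs_neq 0) => h h0 /=.
by rewrite !mxE eqxx andbT addrK [_ *: _]mulrA mulVf// mul1r.
Qed.

End Jacobians.

Section MapJacobians.
Context {R : realType} {m n : nat} {M : riemannian R m} {N : riemannian R n}
  (f : M -> N).
Hypothesis f_smooth : smooth_map f.
Implicit Types (i : cidx M) (j : cidx N) (p : M).

Lemma preim_dom_open j : open (f @^-1` dom j).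
Proof.
have [cf _] := f_smooth; move/continuousP : cf; apply; exact: dom_open.
Qed.

Lemma smooth_at_map i j c p : dom i p -> dom j (f p) ->
  smooth_at i (fun q => chart j (f q) c ord0) p.
Proof.
move=> ip jp; have [_ /(_ j c)] := f_smooth.
by move/(smooth_onP _ (preim_dom_open j)); exact.
Qed.

Lemma smooth_mx_at_dmap i j p : dom i p -> dom j (f p) ->
  smooth_mx_at i (dmap f i j) p.
Proof.
move=> ip jp r s; under [fun q => _]funext do rewrite mxE.
by apply: smooth_at_pd => //; exact: smooth_at_map.
Qed.

Lemma dmap_change_dom i i' j p : dom i p -> dom i' p -> dom j (f p) ->
  dmap f i j p = dmap f i' j p *m jac i i' p.
Proof.
move=> ip ip' jp; apply/matrixP => a b; rewrite !mxE (pd_change _ ip ip').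
  by apply: eq_bigr => c _; rewrite !mxE.
exact: smooth_at_map.
Qed.

Lemma dmap_change_cod i j j' p : dom i p -> dom j (f p) -> dom j' (f p) ->
  dmap f i j' p = jac j j' (f p) *m dmap f i j p.
Proof.
move=> ip jp jp'; apply/matrixP => a b; rewrite !mxE.
have [cf _] := f_smooth.
rewrite [LHS](@pd_comp _ _ _ _ _ f i j b (fun q => chart j' q a ord0) p)//.
- by apply: eq_bigr => c _; rewrite !mxE.
- exact: cf.
- by move=> c; exact: smooth_at_map.
- exact: smooth_at_chart.
Qed.

Lemma field_along0 : field_along f (fun _ _ => 0).
Proof.
split=> [j c|j j' p _ _]; last by rewrite mulmx0.
have o := preim_dom_open j.
apply/(smooth_onP _ o) => i p _ _; under [fun q => _]funext do rewrite mxE.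
exact: smooth_at_cst.
Qed.

End MapJacobians.

(** * The Levi-Civita connection and its curvature *)

Section LeviCivitaTheory.
Context {R : realType} {n : nat} (M : riemannian R n).
Implicit Types (i : cidx M) (p : M) (x y z v w : 'cV[R]_n).

(** The connection form in the coordinate basis: nabla_v is d_v plus this matrix. Matrix notation
    makes the identities below independent of index manipulations. *)
Definition connection_mx i v p : 'M[R]_n :=
  \matrix_(c, b) \sum_a christoffel i c a b p * v a ord0.

Lemma covE i (X Y : M -> 'cV[R]_n) p :
  cov i X Y p = dird_mx i (X p) Y p + connection_mx i (X p) p *m Y p.
Proof.
rewrite /cov dird_cVE; congr (_ + _); apply/colP => c; rewrite !mxE exchange_big.
by apply: eq_bigr => b _; rewrite mxE mulr_suml.
Qed.

Lemma smooth_mx_at_gmet i p : dom i p -> smooth_mx_at i (gmet i) p.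
Proof.
move=> ip r s; have /(smooth_onP _ (dom_open i)) := @gmet_smooth _ _ M i r s.
exact.
Qed.

Lemma gmet_symE i p a b : dom i p -> gmet i p a b = gmet i p b a.
Proof. by move=> ip; rewrite -[in LHS](gmet_sym ip) mxE. Qed.

Lemma gmet_unit i p : dom i p -> gmet i p \in unitmx.
Proof.
move=> ip; rewrite unitmxE unitfE; apply/negP => /det0P[v v0 vg].
have vT0 : v^T != 0 by rewrite -(inj_eq (@trmx_inj _ _ _)) trmxK trmx0.
by have := gmet_pos ip vT0; rewrite trmxK vg mul0mx mxE ltxx.
Qed.

Lemma pd_gmet_sym i k a b p : dom i p ->
  pd i k (fun q => gmet i q a b) p = pd i k (fun q => gmet i q b a) p.
Proof.
by move=> ip; apply: pd_eq => //; apply: filterS (dom_near ip) => q iq;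
  exact: gmet_symE.
Qed.

Lemma christoffel_sym i c a b p : dom i p ->
  christoffel i c a b p = christoffel i c b a p.
Proof.
move=> ip; congr (_ * _); apply: eq_bigr => l _; congr (_ * _).
by rewrite (pd_gmet_sym l a b ip) [in LHS]addrC [in RHS]addrC; congr (_ + _); rewrite addrC.
Qed.

(** Vanishing torsion, read on fields with constant components: they commute, so nabla_x y = nabla_y
    x. *)
Lemma connection_mx_sym i x y p : dom i p ->
  connection_mx i x p *m y = connection_mx i y p *m x.
Proof.
move=> ip; apply/colP => c; rewrite !mxE.
transitivity (\sum_b \sum_a christoffel i c a b p * x a ord0 * y b ord0).
  by apply: eq_bigr => b _; rewrite mxE mulr_suml.
rewrite exchange_big; apply: eq_bigr => b _; rewrite mxE mulr_suml.
by apply: eq_bigr => a _; rewrite christoffel_sym// mulrAC.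
Qed.

(** Lowering the upper index cancels the inverse metric and leaves the Christoffel symbols of the
    first kind. *)
Lemma gmet_connection i v p l b : dom i p ->
  (gmet i p *m connection_mx i v p) l b =
  \sum_a v a ord0 * (2^-1 * (pd i a (fun q => gmet i q b l) p
    + pd i b (fun q => gmet i q a l) p - pd i l (fun q => gmet i q a b) p)).
Proof.
move=> ip; pose F a := \col_l (2^-1 * (pd i a (fun q => gmet i q b l) p
    + pd i b (fun q => gmet i q a l) p - pd i l (fun q => gmet i q a b) p)).
have E a c : christoffel i c a b p = (invmx (gmet i p) *m F a) c ord0.
  rewrite mxE /christoffel mulr_sumr; apply: eq_bigr => k _.
  by rewrite mxE mulrCA.
rewrite mxE; under eq_bigr do rewrite mxE mulr_sumr.
rewrite exchange_big; apply: eq_bigr => a _ /=.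
under eq_bigr do rewrite E mulrA mulrC.
rewrite -mulr_sumr; congr (_ * _).
transitivity ((gmet i p *m (invmx (gmet i p) *m F a)) l ord0); first by rewrite [RHS]mxE.
by rewrite mulKVmx ?gmet_unit// mxE.
Qed.

(** In the sum of a Christoffel symbol of the first kind and its transpose, the derivatives in the
    directions of the two matrix indices cancel, and only the derivative of the metric along [v]
    remains. *)
Lemma metric_compatible i v p : dom i p ->
  dird_mx i v (gmet i) p =
  (connection_mx i v p)^T *m gmet i p + gmet i p *m connection_mx i v p.
Proof.
move=> ip; have -> : (connection_mx i v p)^T *m gmet i p =
    (gmet i p *m connection_mx i v p)^T by rewrite trmx_mul gmet_sym.
apply/matrixP => r s; rewrite mxE [RHS]mxE [X in _ = X + _]mxE !gmet_connection//.
rewrite -big_split; apply: eq_bigr => a _ /=.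
rewrite (pd_gmet_sym a s r ip); set A := pd _ _ _ _; set B := pd _ _ _ _.
set C := pd _ _ _ _; rewrite -mulrDr; congr (_ * _); lra.
Qed.

Lemma smooth_mx_at_connection i v p : dom i p ->
  smooth_mx_at i (connection_mx i v) p.
Proof.
move=> ip r s; under [fun q => _]funext do rewrite mxE.
have Sg : smooth_mx_at i (fun q => invmx (gmet i q)) p.
  apply: smooth_mx_at_inv => //; last exact: smooth_mx_at_gmet.
  by apply: filterS (dom_near ip) => q iq; exact: gmet_unit.
apply: smooth_at_sum => a; apply: smooth_atM; last exact: smooth_at_cst.
apply: smooth_atM; first exact: smooth_at_cst.
apply: smooth_at_sum => l; apply: smooth_atM; first exact: Sg.
by apply: smooth_atB; first apply: smooth_atD; apply: smooth_at_pd => //;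
  exact: smooth_mx_at_gmet.
Qed.

(** The structure equation Omega = d omega + omega /\ omega, evaluated on two fields with constant
    components. *)
Definition curv i p x y : 'M[R]_n :=
  dird_mx i x (connection_mx i y) p - dird_mx i y (connection_mx i x) p
  + connection_mx i x p *m connection_mx i y p
  - connection_mx i y p *m connection_mx i x p.

Lemma connection_mx0 i p : connection_mx i 0 p = 0.
Proof.
by apply/matrixP => a b; rewrite !mxE big1// => c _; rewrite mxE mulr0.
Qed.

Lemma dird_mx0 a b i (A : M -> 'M[R]_(a, b)) p : dird_mx i 0 A p = 0.
Proof.
by apply/matrixP => r s; rewrite !mxE /dird big1// => k _; rewrite mxE mul0r.
Qed.

Lemma curv0r i p x : curv i p x 0 = 0.
Proof.
rewrite /curv dird_mx0.
have -> : connection_mx i 0 = fun=> 0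
  by apply/funext => q; exact: connection_mx0.
by rewrite dird_mx_cst mulmx0 mul0mx !subr0 addr0.
Qed.

(** All fields extended with constant components have zero bracket and zero coordinate derivatives,
    so only derivatives and products of connection matrices survive. *)
Lemma curvatureE i p x y z : dom i p -> curvature i p x y z = curv i p x y *m z.
Proof.
move=> ip.
have cc u w : cov i (fun=> u) (fun=> w) = fun q => connection_mx i u q *m w.
  by apply/funext => q; rewrite covE dird_mx_cst add0r.
have dc u w : cov i (fun=> u) (fun q => connection_mx i w q *m z) p =
    dird_mx i u (connection_mx i w) p *m z
    + connection_mx i u p *m (connection_mx i w p *m z).
  rewrite covE dird_mxM//; last exact: smooth_mx_at_cst.
    by rewrite dird_mx_cst mulmx0 add0r.
  exact: smooth_mx_at_connection.
rewrite /curvature !cc !dc [cov i (lie_bracket _ _ _) _ _]covE.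
rewrite /lie_bracket !dird_cVE !dird_mx_cst subrr connection_mx0 mul0mx.
rewrite addr0 subr0 /curv !mulmxBl !mulmxDl !mulNmx -!mulmxA.
by rewrite opprD !addrA; congr (_ - _); rewrite addrAC.
Qed.

Lemma curvature_mxE i p x y : dom i p -> curvature_mx i p x y = curv i p x y.
Proof.
move=> ip; apply/matrixP => a b; rewrite mxE curvatureE//.
rewrite [LHS]mxE (bigD1 b)//= [evec _ _ _ _]mxE !eqxx mulr1 big1 ?addr0// => c cb.
by rewrite [evec _ _ _ _]mxE (negbTE cb) mulr0.
Qed.

Lemma curv_antisym i p x y : curv i p y x = - curv i p x y.
Proof.
by apply/matrixP => a b; rewrite /curv !mxE; ring.
Qed.

(** Differentiating the torsion-free symmetry gives the same symmetry for the derivatives of the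
    connection matrices ([D]). The terms of the cyclic sum then cancel in pairs. *)
Lemma curv_bianchi i p x y z : dom i p ->
  curv i p x y *m z + curv i p y z *m x + curv i p z x *m y = 0.
Proof.
move=> ip.
have D u v w : dird_mx i u (connection_mx i v) p *m w =
               dird_mx i u (connection_mx i w) p *m v.
  have E s t : dird_mx i u (fun q => connection_mx i s q *m t) p =
      dird_mx i u (connection_mx i s) p *m t.
    rewrite dird_mxM//; last exact: smooth_mx_at_cst.
      by rewrite dird_mx_cst mulmx0 add0r.
    exact: smooth_mx_at_connection.
  rewrite -!E; apply: dird_mx_eq => //.
  by apply: filterS (dom_near ip) => q iq; exact: connection_mx_sym.
rewrite /curv !mulmxBl !mulmxDl !mulNmx -!mulmxA.
rewrite (D x z y) (D y x z) (D z y x).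
rewrite (connection_mx_sym x z ip) (connection_mx_sym y x ip) (connection_mx_sym z y ip).
apply/colP => k; rewrite !mxE; ring.
Qed.

(** Metric compatibility, differentiated once more, expresses the second derivatives of the metric
    through the connection ([E]). Their symmetry in [x] and [y] is the claim. *)
Lemma curv_skew i p x y : dom i p ->
  (curv i p x y)^T *m gmet i p + gmet i p *m curv i p x y = 0.
Proof.
move=> ip.
have SG := smooth_mx_at_gmet ip.
have SC v := smooth_mx_at_connection v ip.
have E u v : dird_mx i u (dird_mx i v (gmet i)) p =
    (dird_mx i u (connection_mx i v) p)^T *m gmet i p
    + (connection_mx i v p)^T *m
        ((connection_mx i u p)^T *m gmet i p + gmet i p *m connection_mx i u p)
    + ((connection_mx i u p)^T *m gmet i p + gmet i p *m connection_mx i u p)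
        *m connection_mx i v p
    + gmet i p *m dird_mx i u (connection_mx i v) p.
  transitivity (dird_mx i u (fun q =>
     (connection_mx i v q)^T *m gmet i q + gmet i q *m connection_mx i v q) p).
    by apply: dird_mx_eq => //; apply: filterS (dom_near ip) => q iq;
      exact: metric_compatible.
  have S1 : smooth_mx_at i (fun q => (connection_mx i v q)^T) p.
    exact: smooth_mx_at_tr.
  rewrite dird_mxD; [|exact: smooth_mx_atM|exact: smooth_mx_atM].
  rewrite !dird_mxM// dird_mx_tr metric_compatible//.
  apply/matrixP => a b; rewrite !mxE; ring.
have /eqP := dird_mx_Schwarz x y ip SG.
rewrite !E -subr_eq0 => /eqP <-; rewrite /curv.
set A := connection_mx i x p; set B := connection_mx i y p.
set DA := dird_mx i y (connection_mx i x) p.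
set DB := dird_mx i x (connection_mx i y) p; set g := gmet i p.
clearbody A B DA DB g; clear.
have tD (U V : 'M[R]_n) : (U + V)^T = U^T + V^T by exact: linearD.
have tB (U V : 'M[R]_n) : (U - V)^T = U^T - V^T by exact: linearB.
rewrite !(tB, tD) !trmx_mul !(mulmxDl, mulmxDr, mulmxBl, mulmxBr) ?mulmxN ?mulNmx !mulmxA.
apply/matrixP => a b; rewrite !mxE; ring.
Qed.

Definition curv4 i p x y z w : R := rdot i p (curv i p x y *m z) w.

Lemma rdotDl i p x y z : rdot i p (x + y) z = rdot i p x z + rdot i p y z.
Proof. by rewrite /rdot linearD /= !mulmxDl mxE. Qed.

Lemma rdotNl i p x z : rdot i p (- x) z = - rdot i p x z.
Proof. by rewrite /rdot linearN /= !mulNmx mxE. Qed.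

Lemma rdot0l i p z : rdot i p 0 z = 0.
Proof. by rewrite /rdot trmx0 !mul0mx mxE. Qed.

Lemma rdot_sym i p x y : dom i p -> rdot i p x y = rdot i p y x.
Proof.
move=> ip; rewrite /rdot.
transitivity ((x^T *m gmet i p *m y)^T ord0 ord0); first by rewrite [RHS]mxE.
by rewrite !trmx_mul trmxK gmet_sym// mulmxA.
Qed.

Lemma curv4_skew i p x y z w : dom i p ->
  curv4 i p x y w z = - curv4 i p x y z w.
Proof.
move=> ip; apply/eqP; rewrite -subr_eq0 opprK [curv4 _ _ _ _ z w]/curv4 rdot_sym//.
rewrite /curv4 /rdot trmx_mul -!mulmxA.
have := curv_skew x y ip => /(congr1 (fun A => (w^T *m (A *m z)) ord0 ord0)).
by rewrite mulmxDl mulmxDr mul0mx mulmx0 -!mulmxA [LHS]mxE [RHS]mxE => ->.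
Qed.

(** [curv_bianchi] cycles the first three slots, whereas here the first slot is fixed and the last
    three are cycled. Four instances of it and the two antisymmetries imply this linearly, as in the
    classical proof of the pair symmetry of the curvature. *)
Lemma curv4_cyclic i p y a b c : dom i p ->
  curv4 i p y a b c + curv4 i p y b c a + curv4 i p y c a b = 0.
Proof.
move=> ip.
have A x x' z w : curv4 i p x' x z w = - curv4 i p x x' z w.
  by rewrite /curv4 curv_antisym mulNmx rdotNl.
have B x x' z w := curv4_skew x x' z w ip.
have Bi x x' z w : curv4 i p x x' z w + curv4 i p x' z x w + curv4 i p z x x' w = 0.
  by rewrite /curv4 -!rdotDl curv_bianchi// rdot0l.
have := (Bi y a b c, Bi y b c a, Bi y c a b, Bi a b c y).
rewrite (B a b c y) (B b c a y) (B c a b y).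
rewrite (A y b a c) (A y c b a) (A y a c b) (B y b c a) (B y c a b) (B y a b c).
by case=> [[[]]]; lra.
Qed.

End LeviCivitaTheory.

(** * Clifford algebra *)

Section HermitianAlgebra.
Context {R : realType}.
Local Notation C := (complex R).
Local Notation cmx := (map_mx (real_complex R)).

Definition adjmx a b (A : 'M[C]_(a, b)) : 'M[C]_(b, a) := map_mx Num.conj A^T.

Lemma adjmxM a b c (A : 'M[C]_(a, b)) (B : 'M[C]_(b, c)) :
  adjmx (A *m B) = adjmx B *m adjmx A.
Proof. by rewrite /adjmx trmx_mul map_mxM. Qed.

Lemma adjmx_sum a b (I : Type) (r : seq I) (F : I -> 'M[C]_(a, b)) :
  adjmx (\sum_(k <- r) F k) = \sum_(k <- r) adjmx (F k).
Proof. by rewrite /adjmx raddf_sum map_mx_sum. Qed.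

Lemma conj_real (x : R) : Num.conj (real_complex R x) = real_complex R x.
Proof. by rewrite -[LHS]/(conjc _) conjc_real. Qed.

Lemma adjmxZ a b (x : R) (A : 'M[C]_(a, b)) :
  adjmx (real_complex R x *: A) = real_complex R x *: adjmx A.
Proof. by apply/matrixP => r s; rewrite !mxE rmorphM /= conj_real. Qed.

Definition herm a (s t : 'cV[C]_a) : C := (adjmx t *m s) ord0 ord0.

Lemma hermDl a (s s' t : 'cV[C]_a) : herm (s + s') t = herm s t + herm s' t.
Proof. by rewrite /herm mulmxDr mxE. Qed.

Lemma hermNl a (s t : 'cV[C]_a) : herm (- s) t = - herm s t.
Proof. by rewrite /herm mulmxN mxE. Qed.

Lemma herm0l a (t : 'cV[C]_a) : herm 0 t = 0.
Proof. by rewrite /herm mulmx0 mxE. Qed.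

Lemma herm_eq0 a (s : 'cV[C]_a) : (complex.Re (herm s s) = 0) <-> s = 0.
Proof.
split=> [|->]; last by rewrite herm0l.
have E : herm s s = real_complex R
      (\sum_r (complex.Re (s r ord0) ^+ 2 + complex.Im (s r ord0) ^+ 2)).
  rewrite /herm mxE rmorph_sum; apply: eq_bigr => r _; rewrite !mxE.
  rewrite -[Num.conj _]/(conjc _); case: (s r ord0) => x y /=.
  by apply/eqP; rewrite eq_complex /= !expr2; apply/andP; split; apply/eqP; ring.
rewrite E /= => /eqP; rewrite psumr_eq0; last first.
  by move=> r _; rewrite addr_ge0// sqr_ge0.
move=> /allP H; apply/colP => r; rewrite mxE.
have := H r; rewrite mem_index_enum => /(_ isT).
rewrite paddr_eq0 ?sqr_ge0// !sqrf_eq0 => /andP[/eqP x0 /eqP y0].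
by case: (s r ord0) x0 y0 => x y /= -> ->.
Qed.

(* [s (x) w], in the encoding of C^d (x)_R R^n as d x n complex matrices. *)
Definition tens d n (s : 'cV[C]_d) (w : 'cV[R]_n) : 'M[C]_(d, n) :=
  s *m (cmx w)^T.

Lemma tensDl d n (s s' : 'cV[C]_d) (w : 'cV[R]_n) :
  tens (s + s') w = tens s w + tens s' w.
Proof. exact: mulmxDl. Qed.

Lemma tensDr d n (s : 'cV[C]_d) (w w' : 'cV[R]_n) :
  tens s (w + w') = tens s w + tens s w'.
Proof. by rewrite /tens map_mxD linearD /= mulmxDr. Qed.

Lemma tensZl d n (x : R) (s : 'cV[C]_d) (w : 'cV[R]_n) :
  tens (real_complex R x *: s) w = tens s (x *: w).
Proof. by rewrite /tens map_mxZ linearZ /= -scalemxAr scalemxAl. Qed.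

Lemma tensNl d n (s : 'cV[C]_d) (w : 'cV[R]_n) : tens (- s) w = - tens s w.
Proof. exact: mulNmx. Qed.

Lemma tens0l d n (w : 'cV[R]_n) : tens (0 : 'cV[C]_d) w = 0.
Proof. exact: mul0mx. Qed.

Lemma tens0r d n (s : 'cV[C]_d) : tens s (0 : 'cV[R]_n) = 0.
Proof. by rewrite /tens map_mx0 trmx0 mulmx0. Qed.

Lemma tens_suml d n (I : Type) (r : seq I) (F : I -> 'cV[C]_d) (w : 'cV[R]_n) :
  tens (\sum_(k <- r) F k) w = \sum_(k <- r) tens (F k) w.
Proof. exact: mulmx_suml. Qed.

Lemma tens_sumr d n (I : Type) (r : seq I) (s : 'cV[C]_d) (F : I -> 'cV[R]_n) :
  tens s (\sum_(k <- r) F k) = \sum_(k <- r) tens s (F k).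
Proof. by rewrite /tens map_mx_sum raddf_sum mulmx_sumr. Qed.

Lemma tensE d n (s : 'cV[C]_d) (w : 'cV[R]_n) r c :
  tens s w r c = s r ord0 * real_complex R (w c ord0).
Proof. by rewrite mxE big_ord1 !mxE. Qed.

End HermitianAlgebra.

Lemma antisym_mxE (R : zmodType) m (w : 'M[R]_m) k l :
  w^T = - w -> w l k = - w k l.
Proof. by move/matrixP/(_ k l); rewrite !mxE. Qed.

(** * Clifford multiplication and the spin representation *)

Section CliffordAlgebra.
Context {R : realType} {m : nat} (G : clifford_module R m).
Local Notation C := (complex R).
Local Notation d := (2 ^ m./2)%N.
Implicit Types (s : 'cV[C]_d).

Lemma adj_gam k : adjmx (gam G k) = - gam G k.
Proof. exact: gam_skew. Qed.

Lemma herm_gam k s t : herm s (gam G k *m t) = - herm (gam G k *m s) t.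
Proof. by rewrite /herm adjmxM adj_gam mulmxN mulNmx mxE mulmxA. Qed.

Lemma gam_swap k l : gam G k *m gam G l =
  (- 2 * (k == l)%:R)%:M - gam G l *m gam G k.
Proof. by apply: (addIr (gam G l *m gam G k)); rewrite subrK gam_anticomm. Qed.

Lemma gam_commutator k l j :
  gam G k *m gam G l *m gam G j - gam G j *m (gam G k *m gam G l) =
  real_complex R (2 * (k == j)%:R) *: gam G l
  - real_complex R (2 * (l == j)%:R) *: gam G k.
Proof.
rewrite -[_ *m _ *m gam G j]mulmxA (gam_swap l j) mulmxBr mul_mx_scalar.
rewrite [in X in _ - X]mulmxA (gam_swap j k) mulmxBl mul_scalar_mx.
rewrite [j == k]eq_sym !mulmxA !rmorphM !rmorph_nat /= !mulNr !scaleNr.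
apply/matrixP => a b; rewrite !mxE; ring.
Qed.

(* The image of w under the differential of the spin representation. *)
Definition spin_gen (w : 'M[R]_m) : 'M[C]_d :=
  4^-1 *: \sum_k \sum_l real_complex R (w k l) *: (gam G k *m gam G l).

(** Infinitesimal form of the covering of SO(m) by Spin(m). Each term of the commutator carries a 2
    from the Clifford relation, and the antisymmetry of [w] makes the two resulting sums equal;
    together they absorb the factor 1/4. *)
Lemma spin_gen_commutator (w : 'M[R]_m) j : w^T = - w ->
  spin_gen w *m gam G j - gam G j *m spin_gen w =
  \sum_l real_complex R (w j l) *: gam G l.
Proof.
move=> wT; have wE k l := antisym_mxE k l wT.
rewrite /spin_gen -scalemxAl -scalemxAr -scalerBr mulmx_suml mulmx_sumr -sumrB.
transitivity (4^-1 *: (\sum_k \sum_l (real_complex R (w k l * (2 * (k == j)%:R)) *: gam G l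
   - real_complex R (w k l * (2 * (l == j)%:R)) *: gam G k))).
  congr (_ *: _); apply: eq_bigr => k _; rewrite mulmx_suml mulmx_sumr -sumrB.
  apply: eq_bigr => l _.
  by rewrite -scalemxAl -scalemxAr -scalerBr gam_commutator scalerBr !scalerA -!rmorphM.
under eq_bigr do rewrite sumrB; rewrite sumrB.
rewrite (bigD1 j)//= [X in _ *: (_ + X - _)]big1 ?addr0; last first.
  by move=> k kj; rewrite big1// => l _; rewrite (negbTE kj) !mulr0 scale0r.
rewrite exchange_big /= [X in _ *: (_ - X)](bigD1 j)//=.
rewrite [X in _ *: (_ - (_ + X))]big1 ?addr0; last first.
  by move=> k kj; rewrite big1// => l _; rewrite (negbTE kj) !mulr0 scale0r.
rewrite eqxx -sumrB scaler_sumr; apply: eq_bigr => l _.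
rewrite (wE j l) -scalerBl scalerA; congr (_ *: _).
have -> : 4^-1 = real_complex R 4^-1 by rewrite fmorphV rmorph_nat.
by rewrite -rmorphB -rmorphM; congr (real_complex R _); rewrite /= mulr1n; lra.
Qed.

(** The adjoint of e_k e_l is e_l e_k, and exchanging the two indices costs a sign because [w] is
    antisymmetric. *)
Lemma adj_spin_gen (w : 'M[R]_m) : w^T = - w ->
  adjmx (spin_gen w) = - spin_gen w.
Proof.
move=> wT; have wE k l := antisym_mxE k l wT.
have E4 : 4^-1 = real_complex R 4^-1 by rewrite fmorphV rmorph_nat.
rewrite /spin_gen E4 adjmxZ -scalerN; congr (_ *: _).
rewrite adjmx_sum -sumrN.
under eq_bigr do rewrite adjmx_sum; under [RHS]eq_bigr do rewrite -sumrN.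
rewrite exchange_big; apply: eq_bigr => k _; apply: eq_bigr => l _.
by rewrite adjmxZ adjmxM !adj_gam mulNmx mulmxN opprK wE rmorphN scaleNr.
Qed.

(** Adding the sum to its copy with [k] and [l] exchanged produces anticommutators, of which only
    the diagonal ones survive. With [B] the second fundamental form this computes D^f Phi; with [B]
    the products u_k u_l it gives u . u . s = - |u|^2 s. *)
Lemma sum_gam_gam n s (B : 'I_m -> 'I_m -> 'cV[R]_n) :
  (forall k l, B k l = B l k) ->
  \sum_k \sum_l tens (gam G k *m (gam G l *m s)) (B k l) =
  - tens s (\sum_k B k k).
Proof.
move=> Bs; set T := LHS.
have E : T + T = \sum_k \sum_l tens ((- 2 * (k == l)%:R) *: s) (B k l).
  rewrite {2}/T exchange_big /T -big_split; apply: eq_bigr => k _.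
  rewrite -big_split; apply: eq_bigr => l _ /=.
  by rewrite (Bs l k) -tensDl !mulmxA -mulmxDl gam_anticomm mul_scalar_mx.
have E2 : T + T = - tens s (\sum_k B k k) + - tens s (\sum_k B k k).
  rewrite E tens_sumr -opprD -big_split -[RHS]sumrN; apply: eq_bigr => k _ /=.
  rewrite (bigD1 k)//= big1 ?addr0; last first.
    by move=> l lk; rewrite eq_sym (negbTE lk) mulr0 scale0r tens0l.
  by rewrite eqxx mulr1 scaleNr scaler_nat mulr2n tensNl tensDl opprD.
have two : (2 : C) != 0 by rewrite pnatr_eq0.
by apply: (scalerI two); rewrite !scaler_nat !mulr2n.
Qed.

(** If u . s = 0 then u . u . s = - |u|^2 s also vanishes, and [u] is real. The scalar |u|^2 is
    written as a vector of length 1 so that [sum_gam_gam] applies. *)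
Lemma clif_inj s (u : 'cV[R]_m) : s <> 0 ->
  \sum_k real_complex R (u k ord0) *: (gam G k *m s) = 0 -> u = 0.
Proof.
move=> s0 us.
have ts0 : tens s (\sum_k (u k ord0 * u k ord0)%:M : 'cV[R]_1) = 0.
  apply: oppr_inj; rewrite oppr0.
  rewrite -(@sum_gam_gam _ s (fun k l => (u l ord0 * u k ord0)%:M)); last first.
    by move=> k l; rewrite mulrC.
  transitivity (\sum_k tens (gam G k *m \sum_l real_complex R (u l ord0) *: (gam G l *m s))
    ((u k ord0)%:M : 'cV[R]_1)).
    apply: eq_bigr => k _; rewrite mulmx_sumr tens_suml; apply: eq_bigr => l _.
    by rewrite -scalemxAr tensZl scale_scalar_mx.
  by apply: big1 => k _; rewrite us mulmx0 tens0l.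
have [r sr] : exists r, s r ord0 != 0.
  apply/existsP; apply: contra_notT s0 => /existsPn H.
  by apply/colP => r; rewrite mxE; apply/eqP; rewrite -[_ == _]negbK.
move/matrixP/(_ r ord0) : ts0; rewrite tensE summxE mxE => /eqP.
rewrite mulf_eq0 (negbTE sr)/= => /eqP[] /eqP.
under eq_bigr do rewrite mxE mulr1n -expr2.
rewrite psumr_eq0 => [/allP H|k _]; last exact: sqr_ge0.
apply/colP => k; rewrite mxE; apply/eqP.
by rewrite -sqrf_eq0; apply: H; rewrite mem_index_enum.
Qed.

Lemma sum3_rot (V : nmodType) (F : 'I_m -> 'I_m -> 'I_m -> V) :
  \sum_k \sum_l \sum_q F l q k = \sum_k \sum_l \sum_q F k l q.
Proof.
by rewrite exchange_big; apply: eq_bigr => l _; rewrite exchange_big.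
Qed.

(* Antisymmetrizing h in its last two arguments makes it totally
   antisymmetric, so only the cyclic sum of Rm contributes. *)
Lemma sum_bianchi (Rm h : 'I_m -> 'I_m -> 'I_m -> C) :
  (forall k l q, Rm k q l = - Rm k l q) ->
  (forall k l q, Rm k l q + Rm l q k + Rm q k l = 0) ->
  (forall k l q, (h k l q - h k q l) + (h l k q - h l q k) = 0) ->
  \sum_k \sum_l \sum_q Rm k l q * h k l q = 0.
Proof.
move=> Ra Rc ha; pose a k l q := h k l q - h k q l.
have a1 k l q : a l k q = - a k l q.
  by apply/eqP; rewrite -subr_eq0 opprK addrC; apply/eqP; exact: ha.
have a2 k l q : a k q l = - a k l q by rewrite /a opprB.
have a3 k l q : a l q k = a k l q by rewrite a2 a1 opprK.
set T := LHS.
pose X := \sum_k \sum_l \sum_q Rm k l q * a k l q.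
(* The part of [X] with [q] and [l] exchanged equals [- T], by relabelling and the antisymmetry of
   [Rm]. *)
have TX : T + T = X.
  have -> : X = T - \sum_k \sum_l \sum_q Rm k l q * h k q l.
    rewrite /X /T -sumrB; apply: eq_bigr => k _.
    rewrite -sumrB; apply: eq_bigr => l _.
    by rewrite -sumrB; apply: eq_bigr => q _; rewrite mulrBr.
  congr (_ + _); rewrite -sumrN; apply: eq_bigr => k _.
  rewrite exchange_big -sumrN; apply: eq_bigr => l _; rewrite -sumrN.
  by apply: eq_bigr => q _; rewrite Ra mulNr.
have X1 : X = \sum_k \sum_l \sum_q Rm l q k * a k l q.
  rewrite /X -sum3_rot; apply: eq_bigr => k _; apply: eq_bigr => l _.
  by apply: eq_bigr => q _; rewrite a3.
have X2 : X = \sum_k \sum_l \sum_q Rm q k l * a k l q.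
  rewrite X1 -sum3_rot; apply: eq_bigr => k _; apply: eq_bigr => l _.
  by apply: eq_bigr => q _; rewrite a3.
have X0 : X + X + X = 0.
  rewrite [X in _ + X]X2 [X in _ + X + _]X1 /X -!big_split big1// => k _ /=.
  rewrite -!big_split big1// => l _ /=; rewrite -!big_split big1// => q _ /=.
  by rewrite -!mulrDl Rc mul0r.
(* Three copies of [X], each equal to [T + T]. *)
have /eqP : T *+ 6 = 0 by rewrite -X0 -TX; ring.
by rewrite mulrn_eq0 => /eqP.
Qed.

End CliffordAlgebra.

Section Tensors.
Context {R : realType}.
Local Notation C := (complex R).
Local Notation cmx := (map_mx (real_complex R)).

Lemma tensor_act_sum m n (A : 'M[C]_(2 ^ m./2)) (B : 'M[R]_n) (I : Type)
    (r : seq I) (F : I -> 'M[C]_(2 ^ m./2, n)) :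
  tensor_act A B (\sum_(k <- r) F k) = \sum_(k <- r) tensor_act A B (F k).
Proof. by rewrite /tensor_act mulmx_sumr mulmx_suml. Qed.

Lemma tensor_act_tens m n (A : 'M[C]_(2 ^ m./2)) (B : 'M[R]_n) s w :
  tensor_act A B (tens s w) = tens (A *m s) (B *m w).
Proof. by rewrite /tensor_act /tens map_mxM trmx_mul !mulmxA. Qed.

Lemma col_mulE a b (A : 'M[R]_(a, b)) (v : 'cV[R]_b) :
  A *m v = \sum_k v k ord0 *: col k A.
Proof.
apply/colP => r; rewrite mxE summxE; apply: eq_bigr => k _.
by rewrite !mxE mulrC.
Qed.

End Tensors.

(** * Orthonormal frames and the second fundamental form *)

Section Frames.
Context {R : realType} {m : nat} {M : riemannian R m}
  {G : clifford_module R m} (S : spin_structure M G).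
Local Notation C := (complex R).
Implicit Types (a b : sidx S) (i : cidx M) (p : M) (v : 'cV[R]_m).

Lemma sdom_near a p : sdom a p -> \forall q \near p, sdom a q.
Proof. by move=> ap; apply: open_nbhs_nbhs; split => //; exact: sdom_open. Qed.

Lemma smooth_mx_at_frame a i p : sdom a p -> dom i p ->
  smooth_mx_at i (frame a i) p.
Proof.
move=> ap ip k l; have o : open (sdom a `&` dom i).
  by apply: openI; [exact: sdom_open|exact: dom_open].
by have /(smooth_onP _ o) := @frame_smooth _ _ _ _ S a i k l; apply.
Qed.

Lemma frame_mul_tr a i p : sdom a p -> dom i p ->
  frame a i p *m ((frame a i p)^T *m gmet i p) = 1%:M.
Proof. by move=> ap ip; apply: mulmx1C; exact: frame_orthonormal. Qed.

Lemma frame_inv_metric a i p : sdom a p -> dom i p ->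
  invmx (gmet i p) = frame a i p *m (frame a i p)^T.
Proof.
move=> ap ip; have gu := gmet_unit ip.
by rewrite -[RHS](mulmxK gu) -[X in X *m invmx _]mulmxA frame_mul_tr// mul1mx.
Qed.

Definition frame_cov a i v p : 'M[R]_m :=
  dird_mx i v (frame a i) p + connection_mx i v p *m frame a i p.

(** The connection form of the frame: entry (k, l) is g(nabla_v e_k, e_l), the coefficient in the
    spin connection. *)
Definition frame_form a i v p : 'M[R]_m :=
  (frame_cov a i v p)^T *m gmet i p *m frame a i p.

Lemma col_frame_cov a i v p k :
  col k (frame_cov a i v p) = cov i (fun=> v) (fun q => col k (frame a i q)) p.
Proof.
rewrite covE /frame_cov linearD /= [col k (_ *m _)]colE -mulmxA -colE; congr (_ + _).
apply/colP => r; rewrite [LHS]mxE [LHS]mxE [RHS]mxE.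
by under [in RHS]eq_fun do rewrite mxE.
Qed.

Lemma spin_connectionE a i v p :
  spin_connection a i v p = spin_gen G (frame_form a i v p).
Proof.
congr (_ *: _); apply: eq_bigr => k _; apply: eq_bigr => l _.
congr (real_complex R _ *: _).
rewrite -col_frame_cov /rdot /frame_form tr_col -row_mul [LHS]mxE [RHS]mxE.
by apply: eq_bigr => c _; rewrite [row _ _ _ _]mxE [col _ _ _ _]mxE.
Qed.

(** Differentiate the orthonormality relation of the frame and replace the derivative of the metric
    by means of [metric_compatible]. *)
Lemma frame_form_antisym a i v p : sdom a p -> dom i p ->
  (frame_form a i v p)^T = - frame_form a i v p.
Proof.
move=> ap ip; apply/eqP; rewrite -subr_eq0 opprK.
have : dird_mx i v (fun q => (frame a i q)^T *m gmet i q *m frame a i q) p = 0.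
  rewrite -(dird_mx_cst i v 1%:M p); apply: dird_mx_eq => //.
  apply: filterS2 (sdom_near ap) (dom_near ip) => q aq iq.
  exact: frame_orthonormal.
have SF := smooth_mx_at_frame ap ip.
have SFt := smooth_mx_at_tr SF.
have Sg := smooth_mx_at_gmet ip.
rewrite dird_mxM//; last exact: smooth_mx_atM.
rewrite dird_mxM// dird_mx_tr metric_compatible// => H.
rewrite -[X in _ == X]H /frame_form /frame_cov.
rewrite !trmx_mul trmxK gmet_sym// !linearD /= !trmx_mul.
move: (frame a i p) (dird_mx _ _ (frame a i) _) (connection_mx _ _ _) (gmet i p).
move=> F dF C g; rewrite !(mulmxDl, mulmxDr) !mulmxA.
by apply/eqP/matrixP => r s; rewrite !mxE; ring.
Qed.

Lemma frame_covE a i v p : sdom a p -> dom i p ->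
  frame_cov a i v p = frame a i p *m (frame_form a i v p)^T.
Proof.
move=> ap ip; rewrite /frame_form !trmx_mul trmxK gmet_sym// !mulmxA.
by rewrite -[X in X *m frame_cov _ _ _ _]mulmxA frame_mul_tr// mul1mx.
Qed.

Lemma col_frame_covE a i v p k : sdom a p -> dom i p ->
  col k (frame_cov a i v p) =
  \sum_l frame_form a i v p k l *: col l (frame a i p).
Proof.
move=> ap ip; rewrite frame_covE// colE -mulmxA -colE col_mulE.
by apply: eq_bigr => l _; rewrite !mxE.
Qed.

(** Orthonormality makes [(frame a i p)^T *m gmet i p] the inverse of [frame a i p], which yields
    the transition matrix [T] explicitly; [T] is orthogonal because both frames are orthonormal. *)
Lemma frame_change_ex a b i p : sdom a p -> sdom b p -> dom i p ->
  exists T : 'M[R]_m, [/\ frame b i p = frame a i p *m T, T *m T^T = 1%:M &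
    spin_over G (Defs.lift a b p) T].
Proof.
move=> ap bp ip; pose T := (frame a i p)^T *m gmet i p *m frame b i p.
have ET : frame b i p = frame a i p *m T.
  by rewrite /T !mulmxA -[X in X *m frame b i p]mulmxA frame_mul_tr// mul1mx.
clearbody T; exists T; split => //; last exact: lift_over ET.
apply: mulmx1C; rewrite -(frame_orthonormal bp ip) [in RHS]ET trmx_mul.
transitivity (T^T *m ((frame a i p)^T *m gmet i p *m frame a i p) *m T).
  by rewrite frame_orthonormal// mulmx1.
by rewrite !mulmxA.
Qed.

Lemma clif_evec k : clif G (evec R k) = gam G k.
Proof.
rewrite /clif (bigD1 k)//= mxE !eqxx scale1r big1 ?addr0// => l lk.
by rewrite mxE (negbTE lk) scale0r.
Qed.

End Frames.

Section SecondFundamentalForm.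
Context {R : realType} {m n : nat} {M : riemannian R m} {N : riemannian R n}
  (f : M -> N).
Hypothesis f_smooth : smooth_map f.
Implicit Types (i : cidx M) (j : cidx N) (p : M) (v x y : 'cV[R]_m).

Lemma pullback_connectionE i j v p :
  pullback_connection f i j v p = connection_mx j (dmap f i j p *m v) (f p).
Proof. by []. Qed.

Lemma cov_alongE i j v (W : M -> 'cV[R]_n) p :
  cov_along f i j v W p =
  dird_mx i v W p + connection_mx j (dmap f i j p *m v) (f p) *m W p.
Proof. by rewrite /cov_along dird_cVE. Qed.

Lemma second_fundamental_formE i j p x y : dom i p -> dom j (f p) ->
  second_fundamental_form f i j p x y =
  dird_mx i x (dmap f i j) p *m y
  + connection_mx j (dmap f i j p *m x) (f p) *m (dmap f i j p *m y)
  - dmap f i j p *m (connection_mx i x p *m y).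
Proof.
move=> ip jp; rewrite /second_fundamental_form cov_alongE covE dird_mx_cst add0r.
rewrite dird_mxM//; [|exact: smooth_mx_at_dmap|exact: smooth_mx_at_cst].
by rewrite dird_mx_cst mulmx0 add0r.
Qed.

(** The two connection terms are symmetric because the connections of M and of N have no torsion;
    the remaining term is a second derivative of the coordinates of [f]. *)
Lemma second_fundamental_form_sym i j p x y : dom i p -> dom j (f p) ->
  second_fundamental_form f i j p x y = second_fundamental_form f i j p y x.
Proof.
move=> ip jp; rewrite !second_fundamental_formE//.
rewrite (connection_mx_sym x y ip) (connection_mx_sym _ (dmap f i j p *m y) jp).
congr (_ + _ - _); apply/colP => c.
pose u q := chart j (f q) c ord0.
have E v w : (dird_mx i v (dmap f i j) p *m w) c ord0 =
    dird i v (dird i w u) p.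
  have Su : smooth_at i u p by exact: smooth_at_map.
  transitivity (dird_mx i v (fun q => dmap f i j q *m w) p c ord0).
    rewrite dird_mxM//; [|exact: smooth_mx_at_dmap|exact: smooth_mx_at_cst].
    by rewrite dird_mx_cst mulmx0 add0r.
  rewrite mxE; have -> // : (fun q => (dmap f i j q *m w) c ord0) = dird i w u.
  apply/funext => q; rewrite mxE /dird.
  by apply: eq_bigr => k _; rewrite mxE mulrC.
by rewrite !E dird_Schwarz//; exact: smooth_at_map.
Qed.

End SecondFundamentalForm.

Section ComplexSmoothness.
Context {R : realType} {m : nat} {M : manifold R m}.
Local Notation C := (complex R).
Implicit Types (i : cidx M) (p : M).

Lemma csmooth_onP (A : set M) (u : M -> C) : open A ->
  csmooth_on A u <-> forall i p, A p -> dom i p -> csmooth_at i u p.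
Proof.
move=> oA; rewrite /csmooth_on !(smooth_onP _ oA); split.
  by move=> [H1 H2] i p Ap ip; split; [exact: H1|exact: H2].
by move=> H; split => i p Ap ip; have [] := H i p Ap ip.
Qed.

Lemma csmooth_at_eq i (u v : M -> C) p : dom i p ->
  (\forall q \near p, u q = v q) -> csmooth_at i u p -> csmooth_at i v p.
Proof.
by move=> ip uv [S1 S2]; split; [apply: smooth_at_eq S1|apply: smooth_at_eq S2] => //;
  apply: filterS uv => q ->.
Qed.

Lemma csmooth_mx_at_tens d n i (s : M -> 'cV[C]_d) (w : M -> 'cV[R]_n) p :
  csmooth_mx_at i s p -> smooth_mx_at i w p ->
  csmooth_mx_at i (fun q => tens (s q) (w q)) p.
Proof.
move=> Ss Sw; apply: csmooth_mx_atM => //.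
by apply: csmooth_mx_at_tr; exact: csmooth_mx_at_real.
Qed.

Lemma dird_mxC_tens d n i v (s : M -> 'cV[C]_d) (w : M -> 'cV[R]_n) p :
  dom i p -> csmooth_mx_at i s p -> smooth_mx_at i w p ->
  dird_mxC i v (fun q => tens (s q) (w q)) p =
  tens (s p) (dird_mx i v w p) + tens (dird_mxC i v s p) (w p).
Proof.
move=> ip Ss Sw; have Sr := csmooth_mx_at_tr (csmooth_mx_at_real Sw).
by rewrite (dird_mxC_M v ip Ss Sr) dird_mxC_tr dird_mxC_real.
Qed.

End ComplexSmoothness.

Lemma linear_sumE (R : realType) (n b : nat) (F : 'cV[R]_n -> 'cV[R]_b)
    (x : 'cV[R]_n) : linear F -> F x = \sum_k x k ord0 *: F (evec R k).
Proof.
move=> lF.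
have F0 : F 0 = 0.
  have := lF 1 0 0; rewrite scaler0 add0r scale1r => E.
  by apply: (addrI (F 0)); rewrite addr0 -E.
have Fsum (r : seq 'I_n) : F (\sum_(k <- r) x k ord0 *: evec R k) =
    \sum_(k <- r) x k ord0 *: F (evec R k).
  by elim: r => [|k r IH]; rewrite ?big_nil// !big_cons lF IH.
rewrite -Fsum; congr F; apply/colP => r; rewrite summxE (bigD1 r)//= !mxE !eqxx.
rewrite mulr1 big1 ?addr0// => k kr.
by rewrite !mxE [r == k]eq_sym (negbTE kr) mulr0.
Qed.

(** * The Hermitian product on the twisted bundle *)

Section HermitianFibre.
Context {R : realType} {m n : nat} {M : riemannian R m} {N : riemannian R n}
  (f : M -> N).
Local Notation C := (complex R).
Local Notation d := (2 ^ m./2)%N.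
Implicit Types (j : cidx N) (p : M).

Lemma twisted_herm_suml j p (I : Type) (r : seq I) (F : I -> 'M[C]_(d, n)) Q :
  twisted_herm f j p (\sum_(k <- r) F k) Q =
  \sum_(k <- r) twisted_herm f j p (F k) Q.
Proof.
rewrite /twisted_herm [RHS]exchange_big /=; apply: eq_bigr => b _.
rewrite [RHS]exchange_big /=; apply: eq_bigr => c _.
rewrite -mulr_sumr; congr (_ * _); rewrite [RHS]exchange_big /=.
by apply: eq_bigr => s _; rewrite summxE mulr_suml.
Qed.

Lemma twisted_herm_sumr j p (I : Type) (r : seq I) (F : I -> 'M[C]_(d, n)) P :
  twisted_herm f j p P (\sum_(k <- r) F k) =
  \sum_(k <- r) twisted_herm f j p P (F k).
Proof.
rewrite /twisted_herm [RHS]exchange_big /=; apply: eq_bigr => b _.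
rewrite [RHS]exchange_big /=; apply: eq_bigr => c _.
rewrite -mulr_sumr; congr (_ * _); rewrite [RHS]exchange_big /=.
by apply: eq_bigr => s _; rewrite summxE rmorph_sum mulr_sumr.
Qed.

Lemma twisted_herm_tens j p (s t : 'cV[C]_d) (u w : 'cV[R]_n) :
  twisted_herm f j p (tens s u) (tens t w) =
  real_complex R (rdot j (f p) u w) * herm s t.
Proof.
have -> : rdot j (f p) u w =
    \sum_b \sum_c u b ord0 * gmet j (f p) b c * w c ord0.
  rewrite /rdot mxE exchange_big; apply: eq_bigr => c _; rewrite mxE mulr_suml.
  by apply: eq_bigr => b _; rewrite mxE.
rewrite rmorph_sum mulr_suml; apply: eq_bigr => b _.
rewrite rmorph_sum mulr_suml; apply: eq_bigr => c _ /=.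
rewrite !rmorphM /= -!mulrA mulrCA; congr (_ * _).
rewrite /herm mxE !mulr_sumr; apply: eq_bigr => r _.
by rewrite !tensE !mxE rmorphM /= conj_real; ring.
Qed.

End HermitianFibre.

(** * The section sum_k e_k . psi (x) df(e_k) *)

Section FirstCase.
Context {R : realType} {m n : nat} {M : riemannian R m} {N : riemannian R n}
  {G : clifford_module R m} (S : spin_structure M G) (f : M -> N)
  (psi : sidx S -> M -> 'cV[complex R]_(2 ^ m./2)).
Hypothesis psi_parallel : parallel_spinor psi.
Hypothesis f_harmonic : harmonic_map f.
Local Notation C := (complex R).
Local Notation d := (2 ^ m./2)%N.
Implicit Types (a : sidx S) (i : cidx M) (j : cidx N) (p : M) (v : 'cV[R]_m).

Let f_smooth : smooth_map f := f_harmonic.1.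

Lemma csmooth_mx_at_spinor a i p : sdom a p -> dom i p ->
  csmooth_mx_at i (psi a) p.
Proof.
move=> ap ip r s; rewrite [s]ord1.
have [[/(_ a r) H _] _] := psi_parallel.
by have /(csmooth_onP _ (sdom_open a)) := H; apply.
Qed.

Lemma dird_spinor a i v p : sdom a p -> dom i p ->
  dird_mxC i v (psi a) p = - (spin_gen G (frame_form a i v p) *m psi a p).
Proof.
move=> ap ip; have [_ /(_ a i p v ap ip)] := psi_parallel.
by rewrite spin_connectionE => /eqP; rewrite addr_eq0 => /eqP.
Qed.

Lemma preim_near j p : dom j (f p) -> \forall q \near p, dom j (f q).
Proof.
move=> jp; have o := preim_dom_open f_smooth j.
exact: (open_nbhs_nbhs (conj o jp)).
Qed.

Definition df_frame a i j p k : 'cV[R]_n :=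
  dmap f i j p *m col k (frame a i p).

(** Derivatives are taken of this version, written in one chart throughout a neighbourhood:
    [df_spinor] chooses a chart at each point separately, with no regularity in the point. The two
    agree wherever both are meaningful. *)
Definition df_spinor_in i a j p : 'M[C]_(d, n) :=
  \sum_k tens (gam G k *m psi a p) (df_frame a i j p k).

(* [sum_k e_k . psi (x) df(e_k)], which does not depend on the chart of M used
   to represent [df] and the frame. *)
Definition df_spinor a j p : 'M[C]_(d, n) :=
  df_spinor_in (sval (cid (dom_cover p))) a j p.

Lemma df_frame_change a i i' j p k : sdom a p -> dom i p -> dom i' p ->
  dom j (f p) -> df_frame a i' j p k = df_frame a i j p k.
Proof.
move=> ap ip ip' jp; rewrite /df_frame (dmap_change_dom f_smooth ip ip' jp).
by rewrite (frame_change ap ip ip') [col k (_ *m _)]colE -mulmxA -colE mulmxA.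
Qed.

Lemma df_spinorE a i j p : sdom a p -> dom i p -> dom j (f p) ->
  df_spinor a j p = df_spinor_in i a j p.
Proof.
move=> ap ip jp; apply: eq_bigr => k _.
by rewrite (@df_frame_change a i)//; case: cid.
Qed.

Lemma df_spinor_near a i j p : sdom a p -> dom i p -> dom j (f p) ->
  \forall q \near p, df_spinor a j q = df_spinor_in i a j q.
Proof.
move=> ap ip jp; apply: filterS3 (sdom_near ap) (dom_near ip) (preim_near jp).
by move=> q; exact: df_spinorE.
Qed.

Lemma smooth_mx_at_col_frame a i p k : sdom a p -> dom i p ->
  smooth_mx_at i (fun q => col k (frame a i q)) p.
Proof.
move=> ap ip r s; under [fun q => _]funext do rewrite mxE.
exact: smooth_mx_at_frame.
Qed.

Lemma smooth_mx_at_df_frame a i j p k : sdom a p -> dom i p -> dom j (f p) ->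
  smooth_mx_at i (fun q => df_frame a i j q k) p.
Proof.
move=> ap ip jp; apply: smooth_mx_atM; first exact: smooth_mx_at_dmap.
exact: smooth_mx_at_col_frame.
Qed.

Lemma csmooth_mx_at_gam_spinor a i p k : sdom a p -> dom i p ->
  csmooth_mx_at i (fun q => gam G k *m psi a q) p.
Proof.
move=> ap ip; apply: csmooth_mx_atM; first exact: csmooth_mx_at_cst.
exact: csmooth_mx_at_spinor.
Qed.

Lemma csmooth_mx_at_df_spinor_in a i j p : sdom a p -> dom i p -> dom j (f p) ->
  csmooth_mx_at i (df_spinor_in i a j) p.
Proof.
move=> ap ip jp; apply: csmooth_mx_at_sum => k; apply: csmooth_mx_at_tens.
  exact: csmooth_mx_at_gam_spinor.
exact: smooth_mx_at_df_frame.
Qed.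

Lemma df_spinor_twisted : twisted_section f df_spinor.
Proof.
split=> [a j r c|a b j p ap bp jp|a j j' p ap jp jp'].
- have o : open (sdom a `&` f @^-1` dom j).
    by apply: openI; [exact: sdom_open|exact: preim_dom_open f_smooth j].
  apply/(csmooth_onP _ o) => i p [ap jp] ip.
  apply: (@csmooth_at_eq _ _ _ i (fun q => df_spinor_in i a j q r c)) => //.
    by apply: filterS (df_spinor_near ap ip jp) => q ->.
  exact: csmooth_mx_at_df_spinor_in.
- have [i ip] := dom_cover p.
  rewrite !(@df_spinorE _ i)// /df_spinor_in tensor_act_sum.
  have [T [ET TT [_ lT]]] := frame_change_ex ap bp ip.
  have [[_ /(_ a b p ap bp) ->] _] := psi_parallel.
  (* The lift intertwines Clifford multiplication by e_l and by T e_l. *)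
  have lg l : Defs.lift a b p *m gam G l =
      \sum_k real_complex R (T k l) *: (gam G k *m Defs.lift a b p).
    rewrite -clif_evec lT /clif mulmx_suml; apply: eq_bigr => k _.
    rewrite -scalemxAl; congr (real_complex R _ *: _).
    rewrite mxE (bigD1 l)//= [evec _ _ _ _]mxE !eqxx mulr1 big1 ?addr0// => c cl.
    by rewrite [evec _ _ _ _]mxE (negbTE cl) mulr0.
  symmetry; under eq_bigr => l _.
    rewrite tensor_act_tens.
    rewrite mul1mx mulmxA lg mulmx_suml tens_suml.
    under eq_bigr do rewrite -scalemxAl tensZl -mulmxA.
    over.
  rewrite exchange_big; apply: eq_bigr => k _ /=.
  rewrite -tens_sumr; congr tens.
  rewrite /df_frame; under eq_bigr do rewrite scalemxAr.
  rewrite -mulmx_sumr; congr (_ *m _).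
  (* The coefficients form row [k] of [T], and F_b T^T = F_a T T^T = F_a for the frame matrices. *)
  transitivity (frame b i p *m (row k T)^T).
    by rewrite col_mulE; apply: eq_bigr => l _; rewrite !mxE.
  by rewrite ET -mulmxA tr_row [col k T^T]colE [T *m _]mulmxA TT mul1mx -colE.
- have [i ip] := dom_cover p.
  rewrite !(@df_spinorE _ i)// /df_spinor_in tensor_act_sum.
  apply: eq_bigr => k _; rewrite tensor_act_tens mul1mx; congr tens.
  by rewrite /df_frame (dmap_change_cod f_smooth ip jp jp') mulmxA.
Qed.

(** The product rule leaves, besides nabla df, the commutator of the spin connection with e_k and
    the term df(nabla_v e_k). Both are governed by the antisymmetric matrix [w], and they cancel
    only after summation over [k]. *)
Lemma twisted_cov_df_spinor a i j v p : sdom a p -> dom i p -> dom j (f p) ->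
  twisted_cov f a i j v (df_spinor a j) p =
  \sum_k tens (gam G k *m psi a p)
    (second_fundamental_form f i j p v (col k (frame a i p))).
Proof.
move=> ap ip jp; rewrite /twisted_cov.
set w := frame_form a i v p; pose A := spin_gen G w.
pose B := pullback_connection f i j v p.
have -> : dird_mxC i v (df_spinor a j) p = dird_mxC i v (df_spinor_in i a j) p.
  by apply: dird_mxC_eq => //; exact: df_spinor_near.
have Sp k := csmooth_mx_at_gam_spinor k ap ip.
have Sw k := smooth_mx_at_df_frame k ap ip jp.
rewrite dird_mxC_sum => [|k]; last exact: csmooth_mx_at_tens.
rewrite (df_spinorE ap ip jp) !tensor_act_sum -!big_split /= spin_connectionE -/w -/A -/B.
(* The derivative of psi is minus the spin connection applied to psi, which turns the spin terms
   into a commutator; the pullback connection is absorbed into the second fundamental form. *)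
have step k : dird_mxC i v (fun q => tens (gam G k *m psi a q) (df_frame a i j q k)) p
    + tensor_act A 1%:M (tens (gam G k *m psi a p) (df_frame a i j p k))
    + tensor_act 1%:M B (tens (gam G k *m psi a p) (df_frame a i j p k))
  = tens (gam G k *m psi a p)
      (second_fundamental_form f i j p v (col k (frame a i p)))
    + (tens ((A *m gam G k - gam G k *m A) *m psi a p) (df_frame a i j p k)
       + tens (gam G k *m psi a p) (dmap f i j p *m col k (frame_cov a i v p))).
  rewrite dird_mxC_tens// !tensor_act_tens !mul1mx.
  rewrite dird_mxC_M//; [|exact: csmooth_mx_at_cst|exact: csmooth_mx_at_spinor].
  rewrite dird_mxC_cst mul0mx addr0 dird_spinor// -/w -/A.
  have -> : dird_mx i v (fun q => df_frame a i j q k) p =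
      second_fundamental_form f i j p v (col k (frame a i p))
      + dmap f i j p *m col k (frame_cov a i v p) - B *m df_frame a i j p k.
    rewrite dird_mxM//; [|exact: smooth_mx_at_dmap|exact: smooth_mx_at_col_frame].
    rewrite second_fundamental_formE// col_frame_cov covE mulmxDr.
    rewrite /B pullback_connectionE /df_frame.
    by apply/colP => c; rewrite !mxE; ring.
  rewrite mulmxBl tensDl mulmxN !tensNl !tensDr -!mulmxA.
  have -> : tens (gam G k *m psi a p) (- (B *m df_frame a i j p k)) =
      - tens (gam G k *m psi a p) (B *m df_frame a i j p k).
    by rewrite /tens map_mxN linearN /= mulmxN.
  do ?[move: (tens _ _) => ?].
  by apply/matrixP => r c; rewrite !mxE; ring.
under eq_bigr do rewrite step.
rewrite big_split /= -[RHS]addr0; congr (_ + _).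
have wT := frame_form_antisym v ap ip.
rewrite big_split /=.
(* [E1] and [E2] expand the two extra terms into the same double sum with opposite signs, up to
   exchanging [k] and [l]. *)
have E1 k : tens ((A *m gam G k - gam G k *m A) *m psi a p) (df_frame a i j p k)
    = \sum_l tens (gam G l *m psi a p) (w k l *: df_frame a i j p k).
  rewrite spin_gen_commutator// mulmx_suml tens_suml; apply: eq_bigr => l _.
  by rewrite -scalemxAl tensZl.
have E2 k : tens (gam G k *m psi a p) (dmap f i j p *m col k (frame_cov a i v p))
    = - \sum_l tens (gam G k *m psi a p) (w l k *: df_frame a i j p l).
  rewrite col_frame_covE// mulmx_sumr tens_sumr -sumrN; apply: eq_bigr => l _.
  rewrite -/w (antisym_mxE k l wT) scaleNr /tens map_mxN linearN /= mulmxN opprK.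
  by rewrite -scalemxAr.
under eq_bigr do rewrite E1; under [X in _ + X]eq_bigr do rewrite E2.
by rewrite sumrN exchange_big subrr.
Qed.

Lemma second_fundamental_form_linear i j p x : dom i p -> dom j (f p) ->
  linear (second_fundamental_form f i j p x).
Proof.
move=> ip jp c y z; rewrite !second_fundamental_formE//.
rewrite !(mulmxDr, =^~ scalemxAr) !scalerDr scalerN.
by apply/colP => r; rewrite !mxE; ring.
Qed.

(** The inverse metric is F F^T for the frame matrix F, so the trace in coordinates becomes the sum
    over the frame. *)
Lemma tension_frame a i j p : sdom a p -> dom i p -> dom j (f p) ->
  tension f i j p = \sum_k
    second_fundamental_form f i j p (col k (frame a i p)) (col k (frame a i p)).
Proof.
move=> ap ip jp; have L x := second_fundamental_form_linear x ip jp.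
have E x y : second_fundamental_form f i j p x y = \sum_c \sum_b
    (x c ord0 * y b ord0) *: second_fundamental_form f i j p (evec R c) (evec R b).
  rewrite second_fundamental_form_sym// (linear_sumE x (L y)).
  apply: eq_bigr => c _; rewrite second_fundamental_form_sym//.
  rewrite (linear_sumE y (L (evec R c))) scaler_sumr.
  by apply: eq_bigr => b _; rewrite scalerA.
under [RHS]eq_bigr do rewrite E.
rewrite exchange_big; apply: eq_bigr => c _ /=.
rewrite exchange_big; apply: eq_bigr => b _ /=.
rewrite -scaler_suml (frame_inv_metric ap ip) mxE; congr (_ *: _).
by apply: eq_bigr => k _; rewrite !mxE.
Qed.

Lemma df_spinor_dirac a i j p : sdom a p -> dom i p -> dom j (f p) ->
  twisted_dirac f a i j (df_spinor a j) p = 0.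
Proof.
move=> ap ip jp; rewrite /twisted_dirac.
transitivity (\sum_l \sum_k tens (gam G l *m (gam G k *m psi a p))
   (second_fundamental_form f i j p (col l (frame a i p)) (col k (frame a i p)))).
  apply: eq_bigr => l _; rewrite twisted_cov_df_spinor// tensor_act_sum.
  by apply: eq_bigr => k _; rewrite tensor_act_tens mul1mx.
rewrite sum_gam_gam => [|k l]; last exact: second_fundamental_form_sym.
by rewrite -tension_frame// (f_harmonic.2 _ _ _ ip jp) tens0r oppr0.
Qed.

Lemma df_spinor_V : is_V f df_spinor (fun _ _ => 0).
Proof.
split; first exact: (field_along0 f_smooth).
move=> a i j p y ap ip jp; rewrite rdot0l rmorph0.
pose w k := df_frame a i j p k.
pose h k l q := herm (gam G k *m (gam G l *m psi a p)) (gam G q *m psi a p).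
pose Rm k l q := real_complex R (curv4 j (f p) y (w k) (w l) (w q)).
transitivity (\sum_k \sum_l \sum_q Rm k l q * h k l q).
  symmetry; apply: sum_bianchi => k l q.
  - by rewrite /Rm curv4_skew// rmorphN.
  - by rewrite /Rm -!rmorphD curv4_cyclic// rmorph0.
  (* The anticommutator of e_k and e_l is a scalar, so it commutes with e_q ([E]). Skewness of
     Clifford multiplication rewrites [h k l q] as minus the product of e_q e_k e_l psi with psi,
     and the required relation becomes [E]. *)
  - pose X b c e := gam G b *m (gam G c *m (gam G e *m psi a p)).
    have E : X q k l + X q l k = X k l q + X l k q.
      transitivity (gam G q *m
        ((gam G k *m gam G l + gam G l *m gam G k) *m psi a p)).
        by rewrite /X mulmxDl mulmxDr -!mulmxA.
      transitivity ((gam G k *m gam G l + gam G l *m gam G k) *m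
        (gam G q *m psi a p)); last by rewrite /X mulmxDl -!mulmxA.
      by rewrite gam_anticomm !mul_scalar_mx scalemxAr.
    have hX k' l' q' : h k' l' q' = - herm (X q' k' l') (psi a p).
      by rewrite /h herm_gam.
    clearbody h X; rewrite !hX -!hermNl -!hermDl -[RHS](herm0l (psi a p)); congr herm.
    have -> : X q k l = X k l q + X l k q - X q l k by rewrite -E addrK.
    by apply/colP => r; rewrite !mxE; ring.
apply: eq_bigr => k _; rewrite (curvature_mxE y _ jp).
rewrite (df_spinorE ap ip jp) tensor_act_sum twisted_herm_suml.
apply: eq_bigr => l _; rewrite tensor_act_tens twisted_herm_sumr.
by apply: eq_bigr => q _; rewrite twisted_herm_tens.
Qed.

End FirstCase.

(** * The case where df vanishes on the support of psi *)

Section Adjoints.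
Context {R : realType} {m : nat} {M : manifold R m}.
Local Notation C := (complex R).
Implicit Types (i : cidx M) (p : M).

Let Re_conj (x : C) : complex.Re (Num.conj x) = complex.Re x.
Proof. by rewrite -[Num.conj _]/(conjc _); case: x. Qed.
Let Im_conj (x : C) : complex.Im (Num.conj x) = - complex.Im x.
Proof. by rewrite -[Num.conj _]/(conjc _); case: x. Qed.

Lemma csmooth_mx_at_adj a b i (A : M -> 'M[C]_(a, b)) p :
  csmooth_mx_at i A p -> csmooth_mx_at i (fun q => adjmx (A q)) p.
Proof.
move=> SA r s; have [S1 S2] := SA s r; split.
  by under [fun q => _]funext do rewrite !mxE Re_conj.
by under [fun q => _]funext do rewrite !mxE Im_conj; exact: smooth_atN.
Qed.

Lemma dird_mxC_adj a b i v (A : M -> 'M[C]_(a, b)) p : dom i p ->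
  csmooth_mx_at i A p ->
  dird_mxC i v (fun q => adjmx (A q)) p = adjmx (dird_mxC i v A p).
Proof.
move=> ip SA; apply/matrixP => r s; have [S1 S2] := SA s r.
rewrite dird_mxCE [RHS]mxE [X in Num.conj X]mxE dird_mxCE -[Num.conj _]/(conjc _) /cdird /=.
under [fun q => complex.Re _]funext do rewrite !mxE Re_conj.
under [fun q => complex.Im _]funext do rewrite !mxE Im_conj.
by rewrite dirdN.
Qed.

Lemma adjmxN a b (A : 'M[C]_(a, b)) : adjmx (- A) = - adjmx A.
Proof. by apply/matrixP => r s; rewrite !mxE rmorphN. Qed.

Lemma pd_dird i k (u : M -> R) p : pd i k u p = dird i (evec R k) u p.
Proof.
rewrite /dird (bigD1 k)//= mxE !eqxx mul1r big1 ?addr0// => l lk.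
by rewrite mxE (negbTE lk) mul0r.
Qed.

End Adjoints.

(** * The zeros and the norm of a parallel spinor *)

Section ParallelNorm.
Context {R : realType} {m : nat} {M : riemannian R m}
  {G : clifford_module R m} (S : spin_structure M G)
  (psi : sidx S -> M -> 'cV[complex R]_(2 ^ m./2)).
Hypothesis psi_parallel : parallel_spinor psi.
Implicit Types (a b : sidx S) (i : cidx M) (p : M).

Lemma spinor_eq0 a b p : sdom a p -> sdom b p -> psi a p = 0 -> psi b p = 0.
Proof.
move=> ap bp p0; have [[_ /(_ b a p bp ap) ->] _] := psi_parallel.
by rewrite p0 mulmx0.
Qed.

(** If A is the spin connection along a vector, the derivative of |psi|^2 is - <A psi, psi> - <psi,
    A psi>, which vanishes as A is skew-Hermitian. *)
Lemma parallel_spinor_norm a p : sdom a p ->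
  \forall q \near p, complex.Re (herm (psi a q) (psi a q)) =
                     complex.Re (herm (psi a p) (psi a p)).
Proof.
move=> ap; have [i ip] := dom_cover p.
apply: (locally_cst ip).
apply: filterS2 (sdom_near ap) (dom_near ip) => q aq iq.
have Sp := csmooth_mx_at_spinor psi_parallel aq iq.
have Sa := csmooth_mx_at_adj Sp.
have Sn := csmooth_mx_atM Sa Sp.
split; first by have [] := Sn ord0 ord0.
move=> k; rewrite pd_dird.
have : dird_mxC i (evec R k) (fun q => adjmx (psi a q) *m psi a q) q = 0.
  rewrite dird_mxC_M// dird_mxC_adj// (dird_spinor psi_parallel)//.
  have wT := frame_form_antisym (evec R k) aq iq.
  rewrite adjmxN adjmxM.
  by rewrite adj_spin_gen// !mulmxN opprK mulmxA addNr.
move/matrixP/(_ ord0 ord0); rewrite dird_mxCE mxE.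
by case.
Qed.

Lemma parallel_spinor_near0 a p : sdom a p -> psi a p = 0 ->
  \forall q \near p, psi a q = 0.
Proof.
move=> ap p0; apply: filterS (parallel_spinor_norm ap) => q.
by rewrite p0 herm0l => /herm_eq0.
Qed.

Lemma parallel_spinor_near_neq0 a p : sdom a p -> psi a p <> 0 ->
  \forall q \near p, psi a q <> 0.
Proof.
move=> ap p0; apply: filterS (parallel_spinor_norm ap) => q E q0; apply: p0.
by apply/herm_eq0; rewrite -E q0 herm0l.
Qed.

End ParallelNorm.

Section SecondCase.
Context {R : realType} {m n : nat} {M : riemannian R m} {N : riemannian R n}
  {G : clifford_module R m} (S : spin_structure M G) (f : M -> N)
  (psi : sidx S -> M -> 'cV[complex R]_(2 ^ m./2)).
Hypothesis psi_parallel : parallel_spinor psi.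
Hypothesis f_harmonic : harmonic_map f.
Hypothesis df0 : forall a j p, sdom a p -> dom j (f p) ->
  df_spinor f psi a j p = 0.
Local Notation C := (complex R).
Local Notation d := (2 ^ m./2)%N.
Implicit Types (a b : sidx S) (i : cidx M) (j : cidx N) (p : M) (v : 'cV[R]_m).

Let f_smooth : smooth_map f := f_harmonic.1.

(** For each target component [c], column [c] of the vanishing section is the Clifford product of
    psi with the real vector [u] of the numbers df^c(e_l). [clif_inj] gives [u = 0], and the frame
    is invertible. *)
Lemma dmap_eq0 a i j p : sdom a p -> dom i p -> dom j (f p) -> psi a p <> 0 ->
  dmap f i j p = 0.
Proof.
move=> ap ip jp p0.
suff H : dmap f i j p *m frame a i p = 0.
  rewrite -[LHS]mulmx1 -(frame_mul_tr ap ip) mulmxA H mul0mx//.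
apply/matrixP => c k; rewrite [RHS]mxE.
pose u : 'cV[R]_m := \col_l df_frame f a i j p l c ord0.
have -> : (dmap f i j p *m frame a i p) c k = u k ord0.
  rewrite [RHS]mxE /df_frame [LHS]mxE [RHS]mxE.
  by apply: eq_bigr => l _; rewrite [col _ _ _ _]mxE.
suff -> : u = 0 by rewrite mxE.
apply: (clif_inj p0); apply/colP => r; rewrite [RHS]mxE.
have := df0 ap jp; rewrite (df_spinorE psi f_harmonic ap ip jp).
move=> /matrixP/(_ r c); rewrite summxE [RHS]mxE => <-.
rewrite summxE; apply: eq_bigr => l _.
by rewrite tensE [LHS]mxE [u _ _]mxE mulrC.
Qed.

Lemma map_locally_cst a p : sdom a p -> psi a p <> 0 ->
  \forall q \near p, f q = f p.
Proof.
move=> ap p0; have [i ip] := dom_cover p; have [j jp] := dom_cover (f p).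
have jn := preim_near f_harmonic jp.
have : \forall q \near p, forall c : 'I_n,
    chart j (f q) c ord0 = chart j (f p) c ord0.
  apply: (near_forall (P := fun c q => chart j (f q) c ord0 = chart j (f p) c ord0)) => c.
  apply: (@locally_cst _ _ _ i (fun q => chart j (f q) c ord0)) => //.
  have H : \forall q \near p, dom i q /\ dom j (f q).
    by apply: filterS2 (dom_near ip) jn.
  apply: filterS3 H (sdom_near ap) (parallel_spinor_near_neq0 psi_parallel ap p0).
  move=> q [iq jq] aq q0; split; first exact: smooth_at_map.
  move=> k; have /matrixP/(_ c k) := dmap_eq0 aq iq jq q0.
  by rewrite !mxE.
apply: filterS2 jn => q jq E.
rewrite -(chartK jq) -(chartK jp); congr chart_inv.
by apply/colP.
Qed.

Variables (y0 : N) (j0 : cidx N) (v0 : 'cV[R]_n).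
Hypothesis j0y : dom j0 y0.

(* A union of components of M: |psi| is locally constant, and so is f where
   psi does not vanish. *)
Definition cst_region p : Prop := f p = y0 /\ exists a, sdom a p /\ psi a p <> 0.

(** Stated pointwise for later use: near every point the definition of [cst_spinor] stays in a
    single branch, and can be differentiated there. *)
Lemma cst_region_clopen p :
  (\forall q \near p, cst_region q) \/ (\forall q \near p, ~ cst_region q).
Proof.
have [a ap] := sdom_cover S p.
have [p0|p0] := pselect (psi a p = 0).
  right; apply: filterS2 (sdom_near ap) (parallel_spinor_near0 psi_parallel ap p0).
  move=> q aq q0 [_ [b [bq]]]; apply.
  exact: spinor_eq0 q0.
have nz := parallel_spinor_near_neq0 psi_parallel ap p0.
have fc := map_locally_cst ap p0.
have [E|E] := pselect (f p = y0); [left|right].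
  apply: filterS3 (sdom_near ap) nz fc => q aq q0 fq.
  by split; [rewrite fq|exists a].
by apply: filterS fc => q fq [fq' _]; apply: E; rewrite -fq.
Qed.

Lemma cst_region_neq0 a p : sdom a p -> cst_region p -> psi a p <> 0.
Proof. by move=> ap [_ [b [bp b0]]] a0; apply: b0; exact: spinor_eq0 a0. Qed.

(** [v0] is a tangent vector at [y0] given in the chart [j0]; the Jacobian at [y0] converts it to
    chart [j]. Its components do not depend on [p], as [f] equals [y0] on the whole region. *)
Definition cst_spinor a j p : 'M[C]_(d, n) :=
  if `[< cst_region p >] then tens (psi a p) (jac j0 j y0 *m v0) else 0.

Lemma cst_spinor_in a j p : cst_region p ->
  cst_spinor a j p = tens (psi a p) (jac j0 j y0 *m v0).
Proof. by move=> H; rewrite /cst_spinor asboolT. Qed.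

Lemma cst_spinor_out a j p : ~ cst_region p -> cst_spinor a j p = 0.
Proof. by move=> H; rewrite /cst_spinor asboolF. Qed.

Lemma cst_spinor_twisted : twisted_section f cst_spinor.
Proof.
split=> [a j r c|a b j p ap bp jp|a j j' p ap jp jp'].
- have o : open (sdom a `&` f @^-1` dom j).
    by apply: openI; [exact: sdom_open|exact: preim_dom_open f_smooth j].
  apply/(csmooth_onP _ o) => i p [ap jp] ip.
  have [H|H] := cst_region_clopen p.
    apply: (@csmooth_at_eq _ _ _ i (fun q => tens (psi a q) (jac j0 j y0 *m v0) r c)) => //.
      by apply: filterS H => q Uq; rewrite cst_spinor_in.
    apply: csmooth_mx_at_tens; first exact: csmooth_mx_at_spinor.
    exact: smooth_mx_at_cst.
  apply: (@csmooth_at_eq _ _ _ i (fun=> 0)) => //; last exact: csmooth_at_cst.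
  by apply: filterS H => q Uq; rewrite cst_spinor_out// mxE.
- have [H|H] := pselect (cst_region p).
    rewrite !cst_spinor_in// tensor_act_tens mul1mx.
    by have [[_ /(_ a b p ap bp) <-] _] := psi_parallel.
  by rewrite !cst_spinor_out// /tensor_act mulmx0 mul0mx.
- have [H|H] := pselect (cst_region p).
    rewrite !cst_spinor_in// tensor_act_tens mul1mx mulmxA.
    have [fp _] := H; rewrite fp in jp jp' *.
    by rewrite -jac_trans.
  by rewrite !cst_spinor_out// /tensor_act mulmx0 mul0mx.
Qed.

(** The section is in fact parallel. On the region df = 0 removes the pullback connection, the
    second factor is constant and psi is parallel; elsewhere the section is zero near the point. *)
Lemma cst_spinor_dirac a i j p : sdom a p -> dom i p -> dom j (f p) ->
  twisted_dirac f a i j (cst_spinor a j) p = 0.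
Proof.
move=> ap ip jp; apply: big1 => k _.
suff -> : twisted_cov f a i j (col k (frame a i p)) (cst_spinor a j) p = 0.
  by rewrite /tensor_act mulmx0 mul0mx.
set v := col k _; rewrite /twisted_cov.
have [H|H] := cst_region_clopen p.
  have Up : cst_region p := nbhs_singleton H.
  rewrite pullback_connectionE (dmap_eq0 ap ip jp (cst_region_neq0 ap Up)).
  rewrite mul0mx connection_mx0 cst_spinor_in// !tensor_act_tens mul0mx tens0r addr0.
  rewrite mul1mx.
  rewrite (@dird_mxC_eq _ _ _ _ _ _ _ _
    (fun q => tens (psi a q) (jac j0 j y0 *m v0)))//; last first.
    by apply: filterS H => q Uq; rewrite cst_spinor_in.
  rewrite dird_mxC_tens//; [|exact: csmooth_mx_at_spinor|exact: smooth_mx_at_cst].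
  rewrite dird_mx_cst tens0r add0r (dird_spinor psi_parallel)// tensNl.
  by rewrite spin_connectionE addNr.
have Up : ~ cst_region p := nbhs_singleton H.
rewrite (@dird_mxC_eq _ _ _ _ _ _ _ _ (fun=> 0))//; last first.
  by apply: filterS H => q Uq; rewrite cst_spinor_out.
by rewrite dird_mxC_cst cst_spinor_out// /tensor_act !mulmx0 !mul0mx !addr0.
Qed.

Lemma cst_spinor_V : is_V f cst_spinor (fun _ _ => 0).
Proof.
split; first exact: (field_along0 f_smooth).
move=> a i j p y ap ip jp; rewrite rdot0l rmorph0; apply/esym/big1 => k _.
suff -> : tensor_act (gam G k)
    (curvature_mx j (f p) y (dmap f i j p *m col k (frame a i p))) (cst_spinor a j p) = 0.
  (* The product with 0 is obtained from additivity over an empty sum. *)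
  rewrite -(big_nil 0 +%R xpredT (fun x : nat => (0 : 'M[C]_(d, n)))).
  by rewrite twisted_herm_suml big_nil.
have [Up|Up] := pselect (cst_region p).
  rewrite (dmap_eq0 ap ip jp (cst_region_neq0 ap Up)) mul0mx curvature_mxE//.
  by rewrite curv0r /tensor_act map_mx0 trmx0 mulmx0.
by rewrite cst_spinor_out// /tensor_act mulmx0 mul0mx.
Qed.

Lemma cst_spinor_nontrivial a p : sdom a p -> psi a p <> 0 -> f p = y0 ->
  v0 <> 0 -> nontrivial_twisted f cst_spinor.
Proof.
move=> ap p0 fp nv0; exists a, j0, p; split=> //; first by rewrite fp.
rewrite cst_spinor_in; last by split=> //; exists a.
rewrite jac_id// mul1mx => t0; apply: p0; apply/colP => r; rewrite mxE.
apply/eqP; apply: contra_notT nv0 => r0; apply/colP => c; rewrite mxE.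
move/matrixP/(_ r c) : t0; rewrite tensE mxE => /eqP.
by rewrite mulf_eq0 (negbTE r0) => /eqP[].
Qed.

End SecondCase.

Theorem proposition2p5 (R : realType) (m : nat) (M : riemannian R m)
    (G : clifford_module R m) (S : spin_structure M G)
    (parallel_exists : exists psi : sidx S -> M -> 'cV[complex R]_(2 ^ m./2),
       parallel_spinor psi /\ nontrivial_spinor psi)
    (N : riemannian R m.+1) (f : M -> N) (f_harmonic : harmonic_map f) :
  exists Phi : sidx S -> cidx N -> M -> 'M[complex R]_(2 ^ m./2, m.+1),
    [/\ twisted_section f Phi, nontrivial_twisted f Phi &
        dirac_harmonic f Phi].
Proof.
have [psi [psi_parallel [a0 [p0 [ap0 p00]]]]] := parallel_exists.
have [f_smooth f_tension] := f_harmonic.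
(* Both sections have V = 0, so in each case the second equation reduces to harmonicity. *)
have T0 i j p : dom i p -> dom j (f p) ->
    tension f i j p = 2^-1 *: (fun _ _ => 0 : 'cV[R]_m.+1) j p.
  by move=> ip jp; rewrite f_tension// scaler0.
have [nt|tr] := pselect (nontrivial_twisted f (df_spinor f psi)).
  have tw := df_spinor_twisted psi_parallel f_harmonic.
  exists (df_spinor f psi); split => //; split => //.
    move=> a i j p ap ip jp; exact: df_spinor_dirac.
  by exists (fun _ _ => 0) => //; exact: df_spinor_V.
have df0 a j p : sdom a p -> dom j (f p) -> df_spinor f psi a j p = 0.
  by move=> ap jp; apply: contrapT => ne; apply: tr; exists a, j, p.
have [j0 jp0] := dom_cover (f p0).
(* A nonzero vector exists because the target has dimension m + 1 > 0. *)
pose v0 : 'cV[R]_m.+1 := evec R ord0.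
have v00 : v0 <> 0.
  by move=> /colP/(_ ord0)/eqP; rewrite !mxE eqxx oner_eq0.
have tw := cst_spinor_twisted psi_parallel f_harmonic df0 v0 jp0.
exists (cst_spinor f psi (f p0) j0 v0); split => //.
  exact: cst_spinor_nontrivial ap0 p00 _ v00.
split => //.
  move=> a i j p ap ip jp; exact: cst_spinor_dirac.
by exists (fun _ _ => 0) => //; exact: cst_spinor_V.
Qed.
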